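(* Let $G$ be a finite group of order $|G|=\ell$ and let $2\leq q\leq e_\ell$, where $e_\ell=\min\{m: m \text{ is a prime divisor of } \ell\}$. Suppose that $X$ is a paracompact free $G$-space and $Y$ is a Hausdorff space such that the connectivity of $F(Y,\ell,q)$ is at least $\mathrm{secat}\left(F(Y,\ell,q)\to F(Y,\ell,q)/G\right)-2$. Then the following statements are equivalent: (i) $\mathrm{secat}(X\to X/G)> \mathrm{secat}\left(F(Y,\ell,q)\to F(Y,\ell,q)/G\right)$. (ii) The triple $(X,G;Y)$ satisfies the $q$-th Borsuk-Ulam property.
   Context: ''Space'' means topological space and ''map'' means continuous map. A free $G$-space is a Hausdorff space $X$ on which the finite group $G$ acts freely on the left; $X\to X/G$ denotes the quotient map (a fibration). The triple $(X,G;Y)$ satisfies the $q$-th Borsuk-Ulam property if for every map $f:X\to Y$ there exist a point $x\in X$ and distinct $u_1,\ldots,u_q\in G$ such that $f(u_1x)=\cdots=f(u_qx)$. The configuration-like space $F(Y,\ell,q)\subset Y^\ell$ (subspace topology) is the set of all $(y_1,\ldots,y_\ell)\in Y^\ell$ such that for any indices $0<i_1<\cdots<i_q\leq\ell$ at least two of $y_{i_1},\ldots,y_{i_q}$ are different. Fix an enumeration $G=\{g_1,\ldots,g_\ell\}$ and let $h:G\to\{1,\ldots,\ell\}$ be the bijection $h(g_j)=j$. The group $G$ acts on the left on $Y^\ell$ by $g(y_1,\ldots,y_\ell)=(y_{h(g^{-1}g_1)},\ldots,y_{h(g^{-1}g_\ell)})$; this restricts to a left action on $F(Y,\ell,q)$,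 which is free when $q\leq e_\ell$. For a fibration $p:E\to B$, the sectional category $\mathrm{secat}(p)$ is the minimal cardinality of an open cover of $B$ such that each element $U$ of the cover admits a local section of $p$ (a map $s:U\to E$ with $p\circ s$ equal to the inclusion $U\hookrightarrow B$); $\mathrm{secat}(p)=\infty$ if no such finite cover exists. A space has connectivity at least $m$ if it is $m$-connected. *)

(* Defs.v *)
From HB Require Import structures.
From mathcomp Require Import all_boot all_order all_algebra all_fingroup.
From mathcomp Require Import generic_quotient.
From mathcomp Require Import boolp classical_sets functions cardinality.
From mathcomp Require Import reals ereal topology normedtype.

Set Implicit Arguments.
Unset Strict Implicit.
Unset Printing Implicit Defensive.

Import Order.TTheory GRing.Theory Num.Theory.
Import numFieldNormedType.Exports.

Local Open Scope classical_set_scope.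
Local Open Scope ring_scope.

(* A finite group carries the discrete topology, so joint continuity of an
   action amounts to continuity of every translation. *)
Record left_action (G : finGroupType) (X : topologicalType) := LeftAction {
  lact :> G -> X -> X;
  lact1 : forall x, lact 1%g x = x;
  lactM : forall g h x, lact (g * h)%g x = lact g (lact h x);
  lact_continuous : forall g, continuous (lact g)
}.

Definition free_action (G : finGroupType) (X : topologicalType)
    (a : left_action G X) :=
  forall (g : G) (x : X), a g x = x -> g = 1%g.

Definition paracompact (X : topologicalType) :=
  forall C : set (set X),
    (forall U, C U -> open U) -> \bigcup_(U in C) U = [set: X] ->
    exists D : set (set X),
      [/\ forall V, D V -> open V,
          \bigcup_(V in D) V = [set: X],
          forall V, D V -> exists2 U, C U & V `<=` U &
          forall x : X, exists2 N, nbhs x N &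
            finite_set [set V | D V /\ V `&` N !=set0]].

Section OrbitSpace.
Variables (G : finGroupType) (X : topologicalType) (a : left_action G X).

Definition same_orbit (x y : X) : bool := [exists g : G, y == a g x].

Lemma same_orbit_equiv : equiv_class_of same_orbit.
Proof.
split=> [x|x y|y x z].
- by apply/existsP; exists 1%g; rewrite lact1.
- by apply/existsP/existsP => -[g /eqP ->]; exists g^-1%g;
    rewrite -lactM mulVg lact1.
- move=> /existsP[g /eqP ->] /existsP[h /eqP ->].
  by apply/existsP; exists (h * g)%g; rewrite lactM.
Qed.

Definition orbit_rel : equiv_rel X := EquivRelPack same_orbit_equiv.

Definition orbit_space : topologicalType :=
  quotient_topology {eq_quot orbit_rel}%qT.

Definition orbit_map (x : X) : orbit_space :=
  (\pi_(quotient_topology {eq_quot orbit_rel}%qT) x)%qT.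

End OrbitSpace.

Section SectionalCategory.
Variables (E B : topologicalType) (p : E -> B).

Definition has_local_section (U : set B) :=
  exists s : U -> E, continuous s /\ forall b : U, p (s b) = \val b.

Definition sectional_cover (n : nat) :=
  exists C : set (set B),
    [/\ (C #= `I_n)%card,
        \bigcup_(U in C) U = [set: B] &
        forall U, C U -> open U /\ has_local_section U].

Definition secat : \bar int :=
  if pselect (exists n, `[< sectional_cover n >]) is left ex
  then (ex_minn ex)%:Z%:E else +oo%E.

End SectionalCategory.

Definition cube (R : realType) (n : nat) : set 'rV[R]_n :=
  [set t | forall i, 0 <= t ord0 i <= 1].
Arguments cube : clear implicits.

Definition cube_boundary (R : realType) (n : nat) : set 'rV[R]_n :=
  cube R n `&` [set t | exists i, t ord0 i = 0 \/ t ord0 i = 1].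
Arguments cube_boundary : clear implicits.

Section Connectivity.
Variables (R : realType) (X : topologicalType).

(* Vanishing of pi_n(X, x0): every map (I^n, dI^n) -> (X, x0) is homotopic
   relative to dI^n to the constant map. For n = 0 the boundary is empty, and
   this says that every point of X is joined to x0 by a path. *)
Definition trivial_homotopy_group (n : nat) (x0 : X) :=
  forall f : 'rV[R]_n -> X,
    {within cube R n, continuous f} ->
    (forall t, cube_boundary R n t -> f t = x0) ->
    exists H : 'rV[R]_n * R -> X,
      [/\ {within cube R n `*` [set s | 0 <= s <= 1], continuous H},
          forall t, cube R n t -> H (t, 0) = f t,
          forall t, cube R n t -> H (t, 1) = x0 &
          forall t s, cube_boundary R n t -> 0 <= s <= 1 -> H (t, s) = x0].

(* The integer m may be negative: every space, including the empty one, is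
   m-connected for m <= -2, and the (-1)-connected spaces are the nonempty
   ones. *)
Definition m_connected (m : int) :=
  (- 1 <= m -> [set: X] !=set0) /\
  (forall (n : nat) (x0 : X), n%:Z <= m -> trivial_homotopy_group n x0).

(* When c = +oo, X has to be m-connected for every m. *)
Definition connectivity_ge (c : \bar int) :=
  forall m : int, (m%:E <= c)%E -> m_connected m.

End Connectivity.

Definition borsuk_ulam_property (G : finGroupType) (X : topologicalType)
    (a : left_action G X) (Y : topologicalType) (q : nat) :=
  forall f : X -> Y, continuous f ->
    exists x : X, exists2 u : 'I_q -> G, injective u &
      forall i j, f (a (u i) x) = f (a (u j) x).

(* F(Y, l, q), coordinates being numbered from 0 to l - 1. *)
Definition conf_set (Y : topologicalType) (l q : nat) :
    set {ptws 'I_l -> Y} :=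
  [set y | forall i : 'I_q -> 'I_l, {homo i : j k / (j < k)%N} ->
     exists j k, y (i j) <> y (i k)].

Definition conf_space (Y : topologicalType) (l q : nat) : topologicalType :=
  set_type (@conf_set Y l q).

Record enumeration (G : finGroupType) (l : nat) := Enumeration {
  elt :> 'I_l -> G;
  idx : G -> 'I_l;
  eltK : cancel elt idx;
  idxK : cancel idx elt
}.

Section ConfigurationAction.
Variables (G : finGroupType) (l : nat) (e : enumeration G l).
Variables (Y : topologicalType) (q : nat).

Definition coord_act (g : G) (y : {ptws 'I_l -> Y}) : {ptws 'I_l -> Y} :=
  fun j => y (idx e (g^-1 * e j)%g).

Lemma coord_act1 y : coord_act 1%g y = y.
Proof. by apply/funext => j; rewrite /coord_act invg1 mul1g eltK. Qed.

Lemma coord_actM g h y : coord_act (g * h)%g y = coord_act g (coord_act h y).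
Proof. by apply/funext => j; rewrite /coord_act idxK invMg mulgA. Qed.

Lemma coord_act_continuous g : continuous (coord_act g).
Proof.
move=> y.
have Fy := @nbhs_filter _ (y : {ptws _ -> _}).
have ? : Filter (coord_act g @ y) by exact: (@fmap_filter _ _ _ _ Fy).
apply/cvg_sup => j A [B [[C oC <-] Cy] /filterS]; apply.
exact: (@proj_continuous _ (fun=> Y) (idx e (g^-1 * e j)%g) y C
  (open_nbhs_nbhs (conj oC Cy))).
Qed.

Lemma conf_set_inj (y : {ptws 'I_l -> Y}) (i : 'I_q -> 'I_l) :
  @conf_set Y l q y -> injective i -> exists j k, y (i j) <> y (i k).
Proof.
move=> Fy inj_i; pose A := (i @: [set: 'I_q])%SET.
have cardA : #|A| = q by rewrite card_imset // cardsT card_ord.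
pose i' j := @enum_val _ (mem A) (cast_ord (esym cardA) j).
have i'E j : exists k, i' j = i k.
  by have /imsetP[k _ ->] : i' j \in A by [exact: enum_valP]; exists k.
have [|j [k]] := Fy i'.
  move=> j k jk; rewrite /i' !(enum_val_nth (i j)) /=.
  have srt : sorted ltn (map val (enum A)).
    have -> : enum A = [seq x <- enum 'I_l | x \in A].
      by rewrite [in RHS]enumT.
    rewrite sorted_map; apply: sorted_filter.
      by move=> ? ? ?; apply: ltn_trans.
    by rewrite -sorted_map val_enum_ord iota_ltn_sorted.
  have szA : size (enum A) = q by rewrite -cardE.
  rewrite -!(nth_map _ 0%N val) ?szA //.
  apply: (sorted_ltn_nth ltn_trans) => //; by rewrite inE size_map szA.
by have [j' ->] := i'E j; have [k' ->] := i'E k; exists j', k'.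
Qed.

Lemma coord_act_conf g y :
  @conf_set Y l q y -> @conf_set Y l q (coord_act g y).
Proof.
move=> Fy i imono; apply: conf_set_inj Fy _ => j k /(can_inj (idxK e)).
move=> /mulgI /(can_inj (eltK e)) ijk; apply/val_inj/eqP.
by case: ltngtP => // /imono; rewrite ijk ltnn.
Qed.

Definition conf_act (g : G) (y : conf_space Y l q) : conf_space Y l q :=
  SigSub (mem_set (coord_act_conf g (set_valP y))).

Lemma conf_act1 y : conf_act 1%g y = y.
Proof. by apply/val_inj; rewrite /= coord_act1. Qed.

Lemma conf_actM g h y : conf_act (g * h)%g y = conf_act g (conf_act h y).
Proof. by apply/val_inj; rewrite /= coord_actM. Qed.

Lemma conf_act_continuous g : continuous (conf_act g).
Proof.
apply: continuous_comp_initial => y.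
have vy := @initial_continuous _ _
  (set_val : conf_space Y l q -> {ptws 'I_l -> Y}) y.
exact: (continuous_comp vy (@coord_act_continuous g (\val y))).
Qed.

Definition conf_action : left_action G (conf_space Y l q) :=
  LeftAction conf_act1 conf_actM conf_act_continuous.

End ConfigurationAction.

(* Main.v *)
Require Import Defs.
From HB Require Import structures.
From mathcomp Require Import all_boot all_order all_algebra all_fingroup.
From mathcomp Require generic_quotient cyclic.
From mathcomp Require Import finmap ring lra zify.
From mathcomp Require Import boolp classical_sets functions cardinality.
From mathcomp Require Import reals ereal topology normedtype.

(* The Borsuk-Ulam property fails exactly when there is an equivariant map
   X -> F = F(Y, l, q): send x to the configuration (f (g_j^-1 x))_j. So the
   claim is that such a map exists iff secat (X -> X/G) <= secat (F -> F/G).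

   A local section over U is the same thing as a slice: an open set A that is
   disjoint from its translates g A and whose translates cover the preimage of
   U. Slices pull back along equivariant maps, whence one direction. For the
   other one, a locally finite family of slices (A_i)_(i in I) covering X
   (finite if secat (F -> F/G) is, given by paracompactness otherwise),
   together with subordinate functions, maps X equivariantly to the join of
   copies of G indexed by I, and the connectivity of F allows one to define an
   equivariant map from this join to F simplex by simplex. *)

Set Implicit Arguments.
Unset Strict Implicit.
Unset Printing Implicit Defensive.

Import Order.TTheory GRing.Theory Num.Theory.
Import numFieldNormedType.Exports.

Local Open Scope classical_set_scope.
Local Open Scope ring_scope.

(** * Extending maps from a sphere to a ball *)

(** The shift by 2 in the connectivity hypothesis is a dimension count: the join of n copies of G
    has dimension n - 1, so only spheres of dimension at most n - 2 have to be filled. Since G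
    permutes the nonempty simplices of the join freely, it is enough to choose fillings on one
    simplex of each orbit. Neither the join nor its topology is constructed. A point is a vector of
    real coordinates indexed by I * G, known up to a positive factor, and the map on a simplex lives
    on the open set of vectors that are positive at some vertex of it, so that continuity is tested
    in a plain product space. As homotopy groups are stated on cubes, a nullhomotopy is turned into
    an extension over a ball by explicit formulas. *)

Section SphereParametrization.
Variables (R : realType) (n : nat).
Implicit Types (u v p : 'rV[R]_n) (h : R) (w : 'rV[R]_n * R).

(** The norm on row vectors is the max norm, so the unit cube is an affine copy of its closed unit
    ball. *)
Definition recenter u : 'rV[R]_n := 2 *: u - const_mx 1.
Definition uncenter v : 'rV[R]_n := 2^-1 *: (v + const_mx 1).

Lemma uncenterK : cancel uncenter recenter.
Proof.
by move=> v; rewrite /recenter scalerA divff ?pnatr_eq0// scale1r addrK.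
Qed.

Lemma rV_norm_le v (c : R) : 0 <= c ->
  (`|v| <= c) <-> forall i, `|v ord0 i| <= c.
Proof.
move=> c0; rewrite [(`|v|)]/Num.norm /= mx_normrE;
  split=> [/bigmax_leP[_ H] i|H].
  by have := H (ord0, i) isT.
by apply/bigmax_leP; split=> // -[i j] _; rewrite ord1 H.
Qed.

Lemma cube_recenter u : cube R n u <-> `|recenter u| <= 1.
Proof.
rewrite rV_norm_le//; split => H i;
  have := H i; rewrite /recenter !mxE ler_norml;
 move=> /andP[? ?]; apply/andP; split; lra.
Qed.

Lemma cube_boundary_recenter u : cube R n u ->
  cube_boundary R n u <-> `|recenter u| = 1.
Proof.
move=> cu; split=> [[_ [i ui]]|u1].
  apply/eqP; rewrite eq_le (cube_recenter u).1//=.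
  rewrite leNgt; apply/negP => u1.
  have := (rV_norm_le (recenter u) (normr_ge0 _)).1 (lexx _) i.
  rewrite leNgt => /negP; apply; apply: (lt_le_trans u1).
  rewrite /recenter !mxE; case: ui => ->; last by rewrite mulr1 ler_normr;
    apply/orP; left; lra.
  by rewrite mulr0 sub0r normrN normr1.
split=> //; apply: contrapT => /forallNP H.
have {}H i : `|recenter u ord0 i| < 1.
  have ui := (rV_norm_le (recenter u) ler01).1 ((cube_recenter u).1 cu) i.
  rewrite lt_neqAle ui andbT; apply/negP => /eqP; rewrite /recenter !mxE => ui1.
  apply: (H i); have := cu i => /andP[? ?].
  move: ui1; case: ger0P => _ ?; [right|left]; lra.
have : `|recenter u| < 1.
  rewrite [(`|_|)]/Num.norm /= mx_normrE; apply/bigmax_ltP; split=> // -[i j] _.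
  by rewrite ord1 H.
by rewrite u1 ltxx.
Qed.

(* The map v |-> spherical v is, up to a positive factor, a homeomorphism from
   the open unit ball onto the unit sphere of 'rV_n * R minus the pole (0, 1),
   and it collapses the boundary of the ball to the pole; [polar] is its
   inverse. *)
Definition spherical v : 'rV[R]_n * R :=
  ((1 - `|v|) *: v, (`|v| - 2^-1) * Num.max `|v| (1 - `|v|)).

Definition l1norm w : R := `|w.1| + `|w.2|.

(** On the ray through [spherical v] this recovers r = [|v|]. The factor [Num.max] in [spherical]
    gives that vector the l1 norm max(r, 1 - r) / 2, which makes r a simple quotient on either side
    of the equator r = 1/2. *)
Definition latitude w : R := (`|w.1| + 2 * Num.max 0 w.2) / (2 * l1norm w).

Definition polar w : 'rV[R]_n := (latitude w / `|w.1|) *: w.1.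

(** The ray includes the origin, where [latitude] divides by zero; off this set [polar] is
    continuous. *)
Definition pole_ray w := w.1 = 0 /\ 0 <= w.2.

Lemma l1norm_ge0 w : 0 <= l1norm w. Proof. exact: addr_ge0. Qed.

Lemma l1norm_gt0 w : w <> (0, 0) -> 0 < l1norm w.
Proof.
case: w => p h w0; rewrite lt_neqAle l1norm_ge0 andbT eq_sym paddr_eq0//=
  !normr_eq0.
by apply/negP => /andP[/eqP p0 /eqP h0]; apply: w0; rewrite p0 h0.
Qed.

Lemma pole_rayN w : ~ pole_ray w -> w.1 != 0 \/ w.1 = 0 /\ w.2 < 0.
Proof.
move=> nw; have [w0|] := eqVneq w.1 0; last by left.
by right; split=> //; rewrite ltNge; apply/negP => h0; apply: nw.
Qed.

Lemma pole_rayN_neq0 w : ~ pole_ray w -> w <> (0, 0).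
Proof. by move=> + w0; rewrite w0 => -[]; split=> /=. Qed.

Lemma polar_norm w : ~ pole_ray w -> `|polar w| = latitude w.
Proof.
move=> nw; have w0 := l1norm_gt0 (pole_rayN_neq0 nw).
have lat0 : 0 <= latitude w.
  by rewrite divr_ge0 ?mulr_ge0 ?addr_ge0 ?l1norm_ge0 ?mulr_ge0 ?le_max ?lexx.
rewrite /polar normrZ normrM ger0_norm// normfV normr_id -mulrA.
case: (pole_rayN nw) => [p0|[p0 h0]]; first by rewrite mulVf ?mulr1 ?normr_eq0.
by rewrite /latitude p0 normr0 add0r max_l ?(ltW h0)// !(mulr0, mul0r).
Qed.

Lemma latitude_le1 w : w <> (0, 0) -> 0 <= latitude w <= 1.
Proof.
move=> /l1norm_gt0 w0; rewrite divr_ge0 ?mulr_ge0 ?addr_ge0 ?l1norm_ge0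
  ?mulr_ge0 ?le_max ?lexx//=.
rewrite ler_pdivrMr ?mulr_gt0// mul1r /l1norm.
have := normr_ge0 w.1; have := ler_norm w.2; have := normr_ge0 w.2.
by case: (leP 0 w.2) => ? ? ? ?; rewrite ?mulr0; lra.
Qed.

(** With r = [latitude w], comparing l1 norms forces the factor max(r, 1 - r) / (2 * [l1norm w]).
    The sign of [w.2] decides on which side of 1/2 the radius r lies. *)
Lemma spherical_polar w : ~ pole_ray w ->
  exists2 c : R, 0 < c & spherical (polar w) = (c *: w.1, c * w.2).
Proof.
move=> nw; have w0 := l1norm_gt0 (pole_rayN_neq0 nw).
rewrite /spherical polar_norm//.
case: w nw w0 => p h; rewrite /latitude /l1norm /= => nw w0.
have [h0|h0] := leP h 0.
  have N2 : `|h| = - h by rewrite ler0_norm.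
  rewrite {}N2 in w0 *.
  set N := `|p| - h in w0 *; rewrite mulr0 addr0.
  set r := `|p| / (2 * N).
  have rl : r <= 2^-1 by rewrite ler_pdivrMr ?mulr_gt0// /N; lra.
  exists ((1 - r) / (2 * N)).
    apply: divr_gt0; last by rewrite mulr_gt0.
    by rewrite subr_gt0 (le_lt_trans rl)// invf_lt1// ltr1n.
  rewrite max_r; last lra.
  congr (_, _).
    rewrite /polar /latitude /l1norm /= max_l // ?mulr0 ?addr0 scalerA.
    have [->|p0] := eqVneq p 0; first by rewrite !scaler0.
    congr (_ *: _); rewrite /r ler0_norm// -/N; field.
    by rewrite normr_eq0 p0 gt_eqF.
  by rewrite [in LHS]mulrC -!mulrA; congr (_ * _); rewrite /r /N; field;
    rewrite gt_eqF.
have p0 : p != 0 by case: (pole_rayN nw) => //= -[_]; rewrite ltNge (ltW h0).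
have pp : 0 < `|p| by rewrite normr_gt0.
have N2 : `|h| = h by rewrite gtr0_norm.
rewrite {}N2 in w0 *.
set N := `|p| + h in w0 *.
set r := (`|p| + 2 * h) / (2 * N).
have rl : 2^-1 <= r.
  by rewrite ler_pdivlMr ?mulr_gt0// /N; lra.
exists (r / (2 * N)).
  apply: divr_gt0; last by rewrite mulr_gt0.
  by apply: lt_le_trans rl; rewrite invr_gt0.
rewrite max_l; last lra.
congr (_, _).
  rewrite /polar /latitude /l1norm /= max_r ?(ltW h0)// (gtr0_norm h0) -/N -/r
    scalerA.
  congr (_ *: _); rewrite /r /N; field.
  by rewrite !gt_eqF.
by rewrite [in LHS]mulrC -!mulrA; congr (_ * _); rewrite /r /N; field;
  rewrite gt_eqF.
Qed.

Lemma spherical_neq0 v : spherical v <> (0, 0).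
Proof.
case=> /eqP; rewrite scaler_eq0 => /orP[v1|/eqP ->]; last first.
  by rewrite normr0 max_r ?subr0// mulr1 => E; lra.
have -> : `|v| = 1 by apply/eqP; rewrite eq_sym -subr_eq0.
by rewrite max_l ?subrr// => E; lra.
Qed.

End SphereParametrization.

Lemma fst_continuous (X Z : topologicalType) : continuous (@fst X Z).
Proof. by move=> x; exact: cvg_fst. Qed.

Lemma snd_continuous (X Z : topologicalType) : continuous (@snd X Z).
Proof. by move=> x; exact: cvg_snd. Qed.

Section SphereExtension.
Variables (R : realType) (n : nat).

Lemma cvg_maxr (T : Type) (A : set_system T) {FA : Filter A}
    (f g : T -> R) (x y : R) :
  f @ A --> x -> g @ A --> y -> Num.max (f z) (g z) @[z --> A] --> Num.max x y.
Proof.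
move=> fx gy; apply: continuous2_cvg fx gy.
exact: (@max_continuous _ R (x, y)).
Qed.

Lemma cvg_subr (T : Type) (A : set_system T) {FA : Filter A}
    (f g : T -> R) (x y : R) :
  f @ A --> x -> g @ A --> y -> f z - g z @[z --> A] --> x - y.
Proof. by move=> fx gy; exact: (@cvgB _ R^o). Qed.

Lemma l1norm_continuous : continuous (@l1norm R n).
Proof.
move=> w; apply: cvgD; apply: cvg_norm; [exact: fst_continuous|].
exact: snd_continuous.
Qed.

Lemma latitude_continuous w : w <> (0, 0) ->
    {for w, continuous (@latitude R n)}.
Proof.
move=> w0; apply: cvgM.
  apply: cvgD; first by apply: cvg_norm; exact: fst_continuous.
  apply: cvgM; first exact: cvg_cst.
  apply: cvg_maxr; first exact: cvg_cst.
  exact: snd_continuous.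
apply: cvgV; first by rewrite mulf_neq0 ?gt_eqF ?l1norm_gt0.
by apply: cvgM; [exact: cvg_cst|exact: l1norm_continuous].
Qed.

Lemma spherical_cvg (T : topologicalType) (f : T -> 'rV[R]_n) x :
  {for x, continuous f} -> {for x, continuous (fun z => spherical (f z))}.
Proof.
move=> cf; have cn : `|f z| @[z --> x] --> `|f x| by exact: cvg_norm.
have c1 (c : R) : (fun _ : T => c) @ x --> c by exact: cvg_cst.
have cn' : 1 - `|f z| @[z --> x] --> 1 - `|f x| by exact: cvg_subr (c1 1) cn.
exact: (cvg_pair (cvgZ cn' cf) (cvgM (cvg_subr cn (c1 2^-1))
  (cvg_maxr cn cn'))).
Qed.

Lemma recenter_cvg (T : topologicalType) (f : T -> 'rV[R]_n) x :
  {for x, continuous f} -> {for x, continuous (fun z => recenter (f z))}.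
Proof. by move=> cf; apply: cvgB; [exact: cvgZl_tmp|exact: cvg_cst]. Qed.

Lemma uncenter_cvg (T : topologicalType) (f : T -> 'rV[R]_n) x :
  {for x, continuous f} -> {for x, continuous (fun z => uncenter (f z))}.
Proof. by move=> cf; apply: cvgZl_tmp; apply: cvgD => //; exact: cvg_cst. Qed.

Lemma pole_rayN_near (w : 'rV[R]_n * R) : ~ pole_ray w ->
    \forall z \near w, ~ pole_ray z.
Proof.
move=> /pole_rayN[p0|[_ h0]].
  have : `|z.1| @[z --> w] --> `|w.1| by apply: cvg_norm; exact: fst_continuous.
  move=> /cvgr_gt/(_ 0); rewrite normr_gt0 => /(_ p0); apply: filterS => z.
  by rewrite normr_gt0 => z0 [/eqP]; rewrite (negPf z0).
have /cvgr_lt/(_ 0 h0) := @snd_continuous 'rV[R]_n R w.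
by apply: filterS => z z0 [_]; rewrite leNgt z0.
Qed.

Lemma polar_continuous w : ~ pole_ray w -> {for w, continuous (@polar R n)}.
Proof.
move=> nw; have w0 := pole_rayN_neq0 nw; have w1 := l1norm_gt0 w0.
case: (pole_rayN nw) => [p0|[_ h0]].
  apply: cvgZ; last exact: fst_continuous.
  apply: cvgM; first exact: latitude_continuous.
  by apply: cvgV; [rewrite normr_eq0|apply: cvg_norm; exact: fst_continuous].
have h0' := h0.
have /cvgr_lt/(_ 0 h0'){}h0 := @snd_continuous 'rV[R]_n R w.
(* Below the equator the factor [|z.1|] cancels, which removes the apparent singularity along the
   negative axis. *)
have E z : z.2 < 0 -> polar z = (2 * l1norm z)^-1 *: z.1.
  move=> z0; rewrite /polar /latitude max_l ?(ltW z0)// mulr0 addr0.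
  have [->|z1] := eqVneq z.1 0; first by rewrite !scaler0.
  by congr (_ *: _); rewrite mulrAC divff ?mul1r// normr_eq0.
have : (fun z => (2 * l1norm z)^-1 *: z.1) @ w --> polar w; last first.
  apply: cvg_trans; apply: near_eq_cvg; near=> z; rewrite E//; near: z;
    exact: h0.
rewrite E//.
apply: cvgZ; last exact: fst_continuous.
apply: cvgV; first by rewrite mulf_neq0 ?gt_eqF.
by apply: cvgM; [exact: cvg_cst|exact: l1norm_continuous].
Unshelve. all: by end_near. Qed.

Lemma cube_compact : compact (cube R n).
Proof.
apply: (@rV_compact R n (fun=> `[0, 1]%classic)) => _.
exact: segment_compact.
Qed.

(* Tube lemma around the part of the cylinder over the cube where the
   nullhomotopy is constant. *)
Lemma cylinder_tube (F : topologicalType) (H : 'rV[R]_n * R -> F) (x0 : F)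
    (U : set F) :
  let Z := cube R n `*` [set s | 0 <= s <= 1] in
  {within Z, continuous H} ->
  (forall t, cube R n t -> H (t, 1) = x0) ->
  (forall t s, cube_boundary R n t -> 0 <= s <= 1 -> H (t, s) = x0) ->
  nbhs x0 U ->
  \forall d \near 0^'+, forall z, Z z ->
    1 - d < Num.max `|recenter z.1| z.2 -> U (H z).
Proof.
move=> Z /subspace_continuousP Hc H1 Hb Ux0.
have cZ : compact Z.
  apply: compact_setX; first exact: cube_compact.
  exact: segment_compact.
pose P (d : R) z := Z z -> 1 - d < Num.max `|recenter z.1| z.2 -> U (H z).
have cg : continuous (fun z : 'rV[R]_n * R => Num.max `|recenter z.1| z.2).
  move=> z; apply: cvg_maxr; last exact: snd_continuous.
  by apply: cvg_norm; apply: recenter_cvg; exact: fst_continuous.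
suff X z : Z z -> \forall z' \near z & d \near 0^'+, P d z'.
  have := (compact_near_coveringP Z).1 cZ R (0^'+) P _ X.
  move=> XP; near=> d => z Zz; suff : P d z by exact.
  by move: z Zz; near: d; exact: XP.
move=> Zz; have [Z1 Z2] := Zz.
have := (cube_recenter _).1 Z1; rewrite le_eqVlt => /orP[/eqP z1|z1].
  have Hz : H z = x0.
    by case: (z) z1 Z1 Z2 => t s /= z1 Z1 Z2; apply: Hb => //;
      apply/cube_boundary_recenter.
  have UH : nbhs (H z) U by rewrite Hz.
  near=> z' d; suff ZU : Z z' -> U (H z') by move=> /ZU.
  by near: z'; exact: Hc z Zz U UH.
have := Z2 => /= /andP[_]; rewrite le_eqVlt => /orP[/eqP z2|z2].
  have Hz : H z = x0 by case: (z) z2 Z1 => t s /= -> ?; exact: H1.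
  have UH : nbhs (H z) U by rewrite Hz.
  near=> z' d; suff ZU : Z z' -> U (H z') by move=> /ZU.
  by near: z'; exact: Hc z Zz U UH.
have g1 : Num.max `|recenter z.1| z.2 < 1 by rewrite gt_max z1 z2.
set g := Num.max _ _ in g1.
(* Away from the lid and the wall of the cylinder the premise itself fails near [z] as soon as d < 1
   - c, for any c strictly between g and 1. *)
pose c := (g + 1) / 2.
have gc : g < c by rewrite /c; lra.
have c1 : c < 1 by rewrite /c; lra.
near=> z' d => /= _ dg; exfalso.
have : Num.max `|recenter z'.1| z'.2 < c.
  by near: z'; apply: cvgr_lt (cg z) _ gc.
have : d < 1 - c by near: d; apply: nbhs_right_lt; lra.
by move: dg; set g' := Num.max _ _; lra.
Unshelve. all: by end_near. Qed.

(** Being constant along rays, [b] amounts to a map on the n-sphere. Pulled back along [spherical]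
    it is a map on the cube, constant on the boundary; a nullhomotopy of it, run at time 1 -
    [l1norm w] cut off at 0, fills the ball. *)
Lemma sphere_extension (F : topologicalType) (b : 'rV[R]_n * R -> F) :
  (forall x0 : F, trivial_homotopy_group R n x0) ->
  (forall c w, 0 < c -> b (c *: w.1, c * w.2) = b w) ->
  (forall w, w <> (0, 0) -> {for w, continuous b}) ->
  exists2 K : 'rV[R]_n * R -> F,
    continuous K & forall w, 1 <= l1norm w -> K w = b w.
Proof.
move=> Fn bZ bc; pose x0 := b (0, 1).
have bray h : 0 < h -> b (0, h) = x0.
  by move=> h0; rewrite -[LHS](bZ h^-1) ?invr_gt0//= scaler0 mulVf ?gt_eqF.
pose f u := b (spherical (recenter u)).
have fc : continuous f.
  move=> u.
  have cs : {for u, continuous (fun v : 'rV[R]_n => spherical (recenter v))}.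
    by apply: spherical_cvg; apply: recenter_cvg => ?.
  exact: (continuous_comp cs (bc _ (@spherical_neq0 _ _ _))).
have fb t : cube_boundary R n t -> f t = x0.
  move=> bt; have : `|recenter t| = 1 by apply/cube_boundary_recenter => //;
    case: bt.
  rewrite /f /spherical => ->; rewrite subrr scale0r max_l// ?mulr1.
  by apply: bray; lra.
have [H [Hc H0 H1 Hb]] := Fn x0 f (continuous_subspaceT fc) fb.
pose th w : 'rV[R]_n * R := (uncenter (polar w), Num.max 0 (1 - l1norm w)).
pose Z := cube R n `*` [set s : R | 0 <= s <= 1].
have Zth w : ~ pole_ray w -> Z (th w).
  move=> nw; split; last by rewrite /= le_max lexx ge_max ler01 gerBl
    l1norm_ge0.
  apply/cube_recenter; rewrite uncenterK polar_norm//.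
  by case/andP: (latitude_le1 (pole_rayN_neq0 nw)).
(* [polar] breaks down on the pole ray, where [H] ought to take its boundary value; that value is
   imposed there, and continuity has to come from [cylinder_tube]. *)
pose K w := if `[< pole_ray w >] then x0 else H (th w).
exists K; last first.
  move=> w w1; rewrite /K; case: asboolP => [[]|nw].
    case: w w1 => p h /= + p0 h0; rewrite /l1norm p0 normr0 add0r ger0_norm//=
      => h1.
    by rewrite bray// (lt_le_trans ltr01).
  rewrite /th max_l ?subr_le0//.
  have [cth _] := Zth _ nw; rewrite H0// /f uncenterK.
  have [c c0 ->] := spherical_polar nw; exact: bZ.
move=> w U; rewrite /K; case: asboolP => [pw|nw]; last first.
  have thc : {for w, continuous th}.
    have c1 : {for w, continuous (fun z => uncenter (polar z))}.
      by apply: uncenter_cvg; exact: polar_continuous.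
    have c2 : Num.max 0 (1 - l1norm z) @[z --> w] --> Num.max 0 (1 - l1norm w).
      apply: cvg_maxr; first exact: cvg_cst.
      by apply: cvg_subr; [exact: cvg_cst|exact: l1norm_continuous].
    exact: (cvg_pair c1 c2).
  move=> /((subspace_continuousP _ _).1 Hc _ (Zth _ nw)) /thc.
  have := pole_rayN_near nw; rewrite !near_simpl /= => nz HU.
  near=> z.
  have zn : ~ pole_ray z by near: z.
  rewrite asboolF//.
  have : Z (th z) by exact: Zth.
  by near: z.
move=> Ux0; have tube := cylinder_tube Hc H1 Hb Ux0.
have [d d0 dU] : exists2 d : R, 0 < d &
    forall z, Z z -> 1 - d < Num.max `|recenter z.1| z.2 -> U (H z).
  near (0 : R)^'+ => d; exists d => //.
  by near: d; exact: tube.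
(* A point near the pole ray is sent close to the wall of the cylinder if the latitude is near 1,
   and close to the lid if the point is near the origin. *)
suff : \forall z \near w, ~ pole_ray z ->
    1 - d < Num.max (latitude z) (1 - l1norm z).
  move=> X; suff : \forall z \near w,
      U (if `[< pole_ray z >] then x0 else H (th z)).
    by [].
  near=> z; case: asboolP => [_|nz]; first exact: nbhs_singleton.
  have zd : 1 - d < Num.max (latitude z) (1 - l1norm z) by move: nz; near: z.
  apply: dU; first exact: Zth.
  rewrite uncenterK polar_norm//; apply: lt_le_trans zd _.
  by rewrite ge_max !le_max lexx/= lexx !orbT.
have [w0|w0] := pselect (w = (0, 0)).
  have /cvgr_lt/(_ d) := @l1norm_continuous w.
  rewrite w0 {1}/l1norm /= !normr0 addr0 => /(_ d0) nd.
  near=> z => _; rewrite lt_max; apply/orP; right.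
  by rewrite ltrD2l ltrN2; near: z.
have lw : latitude w = 1.
  case: pw => p0 h0; have := l1norm_gt0 w0.
  rewrite /latitude /l1norm p0 normr0 !add0r max_r// ger0_norm// => h.
  by rewrite divff// mulf_neq0 ?gt_eqF.
have /cvgr_gt/(_ (1 - d)) := @latitude_continuous w w0.
rewrite lw gtrBl => /(_ d0); apply: filterS => z zd _.
by rewrite lt_max zd.
Unshelve. all: by end_near. Qed.

End SphereExtension.

(** * Filling simplices *)

Lemma near_all_mem (T : Type) (V : eqType) (A : set_system T) {FA : Filter A}
    (s : seq V) (P : V -> T -> Prop) :
  (forall v, v \in s -> \forall x \near A, P v x) ->
  \forall x \near A, forall v, v \in s -> P v x.
Proof.
elim: s => [|v s IH] H; first by near=> x.
have H1 : \forall x \near A, P v x by apply: H; rewrite mem_head.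
have H2 : \forall x \near A, forall v, v \in s -> P v x.
  by apply: IH => u us; apply: H; rewrite in_cons us orbT.
by near=> x => u; rewrite in_cons => /predU1P[->|us]; [near: x|move: u us;
  near: x].
Unshelve. all: by end_near. Qed.

Section PointwiseTopology.
Variables (V : eqType) (Y : topologicalType).

Lemma cvg_ptws (Z : topologicalType) (z : Z) (f : Z -> {ptws V -> Y}) :
  (forall v, {for z, continuous (fun x => f x v)}) -> {for z, continuous f}.
Proof.
move=> H; have FF : Filter (f @ z) by exact: fmap_filter.
apply/cvg_sup => j A [B [[C oC <-] Cy] /filterS]; apply.
by apply: (H j); exact: open_nbhs_nbhs.
Qed.

Lemma eval_continuous (v : V) : continuous (fun t : {ptws V -> Y} => t v).
Proof. by move=> t; exact: (@proj_continuous V (fun=> Y) v t). Qed.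

End PointwiseTopology.

Lemma rV_cvg (R : realType) (n : nat) (Z : topologicalType) (z : Z)
    (f : Z -> 'rV[R]_n) :
  (forall i, {for z, continuous (fun x => f x ord0 i)}) ->
    {for z, continuous f}.
Proof.
move=> H A [B HB /filterS]; apply.
have : \forall x \near z, forall j, j \in enum 'I_n -> B ord0 j (f x ord0 j).
  by apply: near_all_mem => j _; exact: (H j _ (HB ord0 j)).
by apply: filterS => x Hx i j; rewrite ord1; apply: Hx; rewrite mem_enum.
Qed.

(* For k = n.+2 the boundary of a simplex with k vertices is an n-sphere. *)
Definition fillable (R : realType) (F : topologicalType) (k : nat) :=
  match k with
  | 0 => True
  | 1 => [set: F] !=set0
  | n.+2 => forall x0 : F, trivial_homotopy_group R n x0
  end.

Section SimplexFill.
Variables (R : realType) (V : choiceType) (F : topologicalType).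
Implicit Types (S : {fset V}) (t : {ptws V -> R}).

(* t stands for the point of the simplex on S whose barycentric coordinates are
   proportional to Num.max 0 (t v); it exists as soon as t is positive somewhere
   on S, which is an open condition. *)
Definition pos_on S t := exists2 v, v \in S & 0 < t v.

Definition scale_pt (c : R) t : {ptws V -> R} := fun v => c * t v.

Lemma pos_on_scale S t c : 0 < c -> pos_on S t -> pos_on S (scale_pt c t).
Proof. by move=> c0 [v vS tv]; exists v => //; rewrite mulr_gt0. Qed.

Lemma pos_on_near S t : pos_on S t -> \forall t' \near t, pos_on S t'.
Proof.
move=> [v vS tv]; have := cvgr_gt _ (@eval_continuous V R v t) 0 tv.
by move=> H; near=> t'; exists v => //; near: t'; exact: H.
Unshelve. all: by end_near. Qed.

(** The vertex [v0], meant to lie in [S], only provides the start value of the fold. *)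
Definition min_on S (v0 : V) t : R := \big[Num.min/t v0]_(v <- S) t v.

Lemma min_on_le S v0 t v : v \in S -> min_on S v0 t <= t v.
Proof. by move=> vS; exact: ge_bigmin_seq. Qed.

Lemma min_on_attained S v0 t : v0 \in S ->
    exists2 v, v \in S & min_on S v0 t = t v.
Proof.
move=> v0S; rewrite /min_on.
have : forall s : seq V, {subset s <= S} ->
    exists2 v, v \in S & \big[Num.min/t v0]_(v <- s) t v = t v.
  elim=> [|v s IH] sS; first by exists v0; rewrite ?big_nil.
  have [|u uS E] := IH; first by move=> x xs; apply: sS;
      rewrite in_cons xs orbT.
  rewrite big_cons E; case: leP => _; last by exists u.
  by exists v => //; apply: sS; rewrite mem_head.
by apply.
Qed.

Lemma min_on_continuous S v0 : continuous (min_on S v0).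
Proof.
move=> t; rewrite /min_on.
elim: (enum_fset S) => [|v s IH].
  rewrite (_ : (fun _ => _) = (fun t' : {ptws V -> R} => t' v0)).
    exact: eval_continuous.
  by apply/funext => t'; rewrite big_nil.
rewrite (_ : (fun _ => _) = (fun t' : {ptws V -> R} =>
    Num.min (t' v) (\big[Num.min/t' v0]_(v <- s) t' v))); last first.
  by apply/funext => t'; rewrite big_cons.
have ev := @eval_continuous V R v t.
apply: (@continuous2_cvg _ _ _ _ _ _ _ _ _ _ _ _ ev IH).
exact: (@min_continuous _ R (t v, _)).
Qed.

Lemma min_on_eq S v0 t t' : v0 \in S -> {in S, t =1 t'} ->
    min_on S v0 t = min_on S v0 t'.
Proof.
by move=> v0S tt'; rewrite /min_on tt'//; apply: eq_big_seq => v vS;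
  rewrite tt'.
Qed.

Lemma min_on_scale S v0 c t : 0 < c ->
  min_on S v0 (scale_pt c t) = c * min_on S v0 t.
Proof.
move=> c0; rewrite /min_on; elim: (enum_fset S) => [|v s IH];
  first by rewrite !big_nil.
by rewrite !big_cons IH minr_pMr ?ltW.
Qed.

Lemma min_on_shift S v0 t d :
  min_on S v0 (fun v => t v - d) = min_on S v0 t - d.
Proof.
rewrite /min_on; elim: (enum_fset S) => [|v s IH]; first by rewrite !big_nil.
by rewrite !big_cons IH addr_minl.
Qed.

Section Faces.
Variables (S : {fset V}) (s : V -> {ptws V -> R} -> F).
Hypothesis s_agree : forall u v t, u \in S -> v \in S -> pos_on S t ->
  t u <= 0 -> t v <= 0 -> s u t = s v t.
Hypothesis s_cont : forall v t, v \in S -> pos_on (S `\ v)%fset t ->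
    {for t, continuous (s v)}.
Hypothesis s_scale : forall v t c, v \in S -> pos_on (S `\ v)%fset t -> 0 < c ->
  s v (scale_pt c t) = s v t.
Hypothesis s_local : forall v t t', v \in S -> pos_on (S `\ v)%fset t ->
  {in (S `\ v)%fset, t =1 t'} -> s v t = s v t'.

Lemma pos_on_face v t : v \in S -> pos_on S t -> t v <= 0 ->
    pos_on (S `\ v)%fset t.
Proof.
move=> vS [u uS tu] tv; exists u => //; rewrite !inE uS andbT.
by apply: contraTneq tu => ->; rewrite -leNgt.
Qed.

(** A vector with several nonpositive coordinates lies on several faces, and [s_agree] makes the
    choice of the first one immaterial. On vectors positive on all of [S] the value is arbitrary. *)
Lemma face_glue v0 : v0 \in S -> exists g : {ptws V -> R} -> F,
  forall t v, pos_on S t -> v \in S -> t v <= 0 -> g t = s v t.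
Proof.
move=> v0S.
exists (fun t => s (nth v0 S (find (fun v => t v <= 0) S)) t) => t v pt vS tv.
have hS : has (fun v => t v <= 0) S by apply/hasP; exists v.
apply: s_agree => //; last exact: (nth_find v0 hS).
by rewrite mem_nth// -has_find.
Qed.

Variable g : {ptws V -> R} -> F.
Hypothesis gE : forall t v, pos_on S t -> v \in S -> t v <= 0 -> g t = s v t.

(** Nothing is known about [g] off the boundary of the simplex, whence the composition with a map
    [th] into it. Near [z] only the faces containing [th z] matter, because a positive coordinate
    stays positive. *)
Lemma glue_cvg (Z : topologicalType) (z : Z) (th : Z -> {ptws V -> R}) :
  {for z, continuous th} -> pos_on S (th z) ->
  (forall x, exists2 v, v \in S & th x v <= 0) ->
  {for z, continuous (fun x => g (th x))}.
Proof.
move=> thc pz ths U Ugz.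
have N1 : \forall x \near z, pos_on S (th x) by apply: thc; exact: pos_on_near.
have thv v : {for z, continuous (fun x => th x v)}.
  exact: (continuous_comp thc (@eval_continuous V R v (th z))).
have N2 : \forall x \near z, forall v, v \in enum_fset S ->
    th x v <= 0 -> U (s v (th x)).
  apply: near_all_mem => v vS.
  have [tv|tv] := leP (th z v) 0.
    have Us : nbhs (s v (th z)) U by rewrite -(gE pz vS tv).
    have sc := s_cont vS (pos_on_face vS pz tv).
    have := continuous_comp thc sc Us.
    by move=> H; near=> x => _; near: x; exact: H.
  have := cvgr_gt _ (thv v) 0 tv => H.
  by near=> x => xv; exfalso; move: xv; apply/negP; rewrite -ltNge; near: x;
    exact: H.
suff : \forall x \near z, U (g (th x)) by [].
near=> x.
have [v vS xv] := ths x.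
rewrite (gE _ vS xv); last by near: x.
by move: v vS xv; near: x.
Unshelve. all: by end_near. Qed.

Lemma glue_local t t' v : pos_on S t -> v \in S -> t v <= 0 ->
    {in S, t =1 t'} ->
  g t = g t'.
Proof.
move=> pt vS tv tt'; rewrite (gE pt vS tv) (@gE t' v)// -?tt'//.
  apply: s_local => //; first exact: pos_on_face.
  by move=> u; rewrite !inE => /andP[_ uS]; exact: tt'.
by have [u uS tu] := pt; exists u => //; rewrite -tt'.
Qed.

Lemma glue_scale t v c : pos_on S t -> v \in S -> t v <= 0 -> 0 < c ->
  g (scale_pt c t) = g t.
Proof.
move=> pt vS tv c0; rewrite (gE pt vS tv) (@gE _ v)//; last 2 first.
- exact: pos_on_scale.
- by rewrite /scale_pt pmulr_rle0.
by apply: s_scale => //; exact: pos_on_face.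
Qed.

End Faces.
End SimplexFill.

(** * The boundary of a simplex as a sphere of directions *)

Section SimplexCoordinates.
Variables (R : realType) (V : choiceType) (S : {fset V}) (n : nat) (v0 : V).
Hypothesis cardS : #|` S| = n.+2.

Let vtx i := nth v0 S i.
Let l := vtx n.+1.

(** Coordinate vectors on n + 2 vertices, modulo constant vectors, form a space of dimension n + 1.
    [directions] is the quotient map onto it and [coords] the section that vanishes at the last
    vertex [l]. *)
Definition coords (w : 'rV[R]_n * R) : {ptws V -> R} := fun v =>
  if insub (index v S) is Some j then w.1 ord0 (j : 'I_n)
  else if index v S == n then w.2 else 0.

Definition directions (t : {ptws V -> R}) : 'rV[R]_n * R :=
  (\row_j (t (vtx j) - t l), t (vtx n) - t l).

Lemma coords_directions t v : v \in S -> coords (directions t) v = t v - t l.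
Proof.
move=> vS; rewrite /coords.
have iv : (index v S < n.+2)%N by rewrite -cardS index_mem.
case: insubP => [j _ ji|]; first by rewrite mxE ji /vtx nth_index.
rewrite -leqNgt => ni; have [ne|/eqP ne] := eqVneq (index v S) n.
  have vn : vtx n = v by rewrite /vtx -ne nth_index.
  by rewrite /= vn.
have -> : l = v; last by rewrite subrr.
rewrite /l /vtx -[RHS](nth_index v0 vS); congr nth.
apply/eqP; rewrite eqn_leq; apply/andP; split; last by rewrite -ltnS.
by rewrite ltn_neqAle ni eq_sym andbT; apply/eqP.
Qed.

Lemma coords_scale c w : 0 < c ->
  coords (c *: w.1, c * w.2) = scale_pt c (coords w).
Proof.
move=> c0; apply/funext => v; rewrite /coords /scale_pt.
by case: insubP => [j _ _|_] /=; [rewrite mxE|case: ifP; rewrite ?mulr0].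
Qed.

Lemma index_vtx i : (i < n.+2)%N -> index (vtx i) S = i.
Proof. by move=> ni; rewrite index_uniq ?fset_uniq// cardS. Qed.

Lemma vtx_in i : (i < n.+2)%N -> vtx i \in S.
Proof. by move=> ni; rewrite /vtx mem_nth// cardS. Qed.

Lemma coords_last w : coords w l = 0.
Proof.
rewrite /coords index_vtx// insubF ?ltnNge ?leqnSn//.
by rewrite gtn_eqF.
Qed.

Lemma coords_neq0 w : w <> (0, 0) -> exists2 v, v \in S & coords w v != 0.
Proof.
move=> w0; apply: contrapT => H; apply: w0.
have {}H v : v \in S -> coords w v = 0.
  by move=> vS; apply: contrapT => /eqP cv; apply: H; exists v.
rewrite [w]surjective_pairing; congr pair.
  apply/rowP => j; rewrite mxE; have jn : (j < n.+2)%N.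
    by apply: leq_trans (ltn_ord j) _; rewrite leqW.
  have := H _ (vtx_in jn); rewrite /coords index_vtx//.
  by case: insubP => [i _ /val_inj ->//|]; rewrite ltn_ord.
have nn : (n < n.+2)%N by [].
by have := H _ (vtx_in nn); rewrite /coords index_vtx// insubF ?ltnn// eqxx.
Qed.

Lemma coords_continuous (w : 'rV[R]_n * R) : {for w, continuous coords}.
Proof.
apply: cvg_ptws => v; rewrite /coords.
case: (@insub nat (fun i => (i < n)%N) 'I_n (index v S)) => [j|].
  exact: (continuous_comp (@fst_continuous 'rV[R]_n R w)
    (@coord_continuous R 1 n ord0 j w.1)).
by case: (index v S == n); [exact: snd_continuous|exact: cst_continuous].
Qed.

End SimplexCoordinates.

Section SimplexFilling.
Variables (R : realType) (V : choiceType) (F : topologicalType).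
Variables (S : {fset V}) (s : V -> {ptws V -> R} -> F).
Hypothesis s_agree : forall u v t, u \in S -> v \in S -> pos_on S t ->
  t u <= 0 -> t v <= 0 -> s u t = s v t.
Hypothesis s_cont : forall v t, v \in S -> pos_on (S `\ v)%fset t ->
  {for t, continuous (s v)}.
Hypothesis s_scale : forall v t c, v \in S -> pos_on (S `\ v)%fset t -> 0 < c ->
  s v (scale_pt c t) = s v t.
Hypothesis s_local : forall v t t', v \in S -> pos_on (S `\ v)%fset t ->
  {in (S `\ v)%fset, t =1 t'} -> s v t = s v t'.

Definition filling (f : {ptws V -> R} -> F) :=
  [/\ forall t v, pos_on S t -> v \in S -> t v <= 0 -> f t = s v t,
      forall t, pos_on S t -> {for t, continuous f},
      forall t c, pos_on S t -> 0 < c -> f (scale_pt c t) = f t &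
      forall t t', pos_on S t -> {in S, t =1 t'} -> f t = f t'].

Lemma filling_vertex v : S = [fset v]%fset -> [set: F] !=set0 ->
    exists f, filling f.
Proof.
move=> S1 [y _]; exists (fun _ => y); split=> // [t u [w]|t _].
  by rewrite S1 !inE => /eqP -> vp /eqP ->; rewrite leNgt vp.
exact: cst_continuous.
Qed.

(** Subtracting the least coordinate pushes the simplex minus its barycentre onto its boundary, and
    identifies the boundary with the sphere of directions, where [sphere_extension] applies. *)
Lemma filling_simplex n : #|` S| = n.+2 ->
  (forall x0 : F, trivial_homotopy_group R n x0) -> exists f, filling f.
Proof.
move=> cardS Fn.
have [v0 v0S] : exists v0, v0 \in S.
  by have [S0|[v vS]] := fset_0Vmem S; [rewrite S0 cardfs0 in cardS|exists v].
have [g gE] := face_glue s_agree v0S.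
pose m (t : {ptws V -> R}) := min_on S v0 t.
pose D (t : {ptws V -> R}) : {ptws V -> R} := fun v => t v - m t.
pose c w := coords S (n := n) w : {ptws V -> R}.
pose d (t : {ptws V -> R}) := directions S n v0 t.
pose b w := g (D (c w)).
have Dmin t : exists2 v, v \in S & D t v <= 0.
  have [v vS E] := min_on_attained t v0S.
  by exists v; rewrite // /D /m E subrr.
have Dpos t v : v \in S -> t v != m t -> pos_on S (D t).
  by move=> vS tv; exists v => //; rewrite subr_gt0 lt_neqAle eq_sym tv
    min_on_le.
have cpos w : w <> (0, 0) -> pos_on S (D (c w)).
  move=> w0; have [v vS cv] := coords_neq0 v0 cardS w0.
  have lS : nth v0 S n.+1 \in S by apply: (vtx_in v0 cardS).
  have [cm|cm] := eqVneq (c w v) (m (c w)); last exact: (Dpos _ v).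
  by apply: (Dpos _ _ lS); rewrite /c (coords_last v0 cardS) -[m _]cm eq_sym.
have Dscale t k : 0 < k -> D (scale_pt k t) = scale_pt k (D t).
  by move=> k0; apply/funext => v; rewrite /D /m min_on_scale// /scale_pt
    mulrBr.
have bscale k w : 0 < k -> b (k *: w.1, k * w.2) = b w.
  move=> k0; have [->|w0] := pselect (w = (0, 0));
    first by rewrite /= scaler0 mulr0.
  have [v vS Dv] := Dmin (c w).
  rewrite /b /c coords_scale// -/(c w) Dscale//.
  exact: (glue_scale s_scale gE (cpos _ w0) vS Dv).
have Dcont t : {for t, continuous D}.
  apply: cvg_ptws => v.
  exact: (cvg_subr (@eval_continuous V R v t) (@min_on_continuous R V S v0 t)).
have bcont w : w <> (0, 0) -> {for w, continuous b}.
  move=> w0; have Dc : {for w, continuous (fun w => D (c w))}.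
    exact: (continuous_comp (@coords_continuous R V S n w) (Dcont (c w))).
  exact: (glue_cvg s_cont gE Dc (cpos _ w0) (fun x => Dmin (c x))).
have [K Kc KE] := sphere_extension Fn bscale bcont.
(* The barycentre goes to the origin. As the least coordinate tends to 0 from above, [dm t] leaves
   the unit ball, and there [K] is already given by the boundary map. *)
pose dm t : 'rV[R]_n * R := ((m t)^-1 *: (d t).1, (m t)^-1 * (d t).2).
pose f t := if m t <= 0 then g t else K (dm t).
have dcont t : {for t, continuous d}.
  have ev v := @eval_continuous V R v t.
  have c1 : {for t, continuous (fun t' => (d t').1)}.
    apply: rV_cvg => j; rewrite /d /directions /=.
    rewrite (_ : (fun _ => _) = (fun t' : {ptws V -> R} =>
      t' (nth v0 S j) - t' (nth v0 S n.+1))); last by apply/funext => t';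
        rewrite mxE.
    exact: (cvg_subr (ev _) (ev _)).
  exact: (cvg_pair c1 (cvg_subr (ev _) (ev _))).
have mcont := @min_on_continuous R V S v0.
(* Passing from [t] to [c (d t)] subtracts a constant on [S], which [D] cannot see. *)
have gD t : pos_on S t -> 0 < m t -> m t <= l1norm (d t) -> K (dm t) = g (D t).
  move=> pt mt ml.
  have lm : 1 <= l1norm (dm t).
    rewrite /l1norm /dm /= normrZ normrM -mulrDr ger0_norm ?invr_ge0
      ?(ltW mt)//.
    by rewrite mulrC ler_pdivlMr// mul1r.
  rewrite KE// /dm bscale ?invr_gt0// /b.
  have cd : {in S, D (c (d t)) =1 D t}.
    have cdE : {in S, c (d t) =1 fun v => t v - t (nth v0 S n.+1)}.
      by move=> v vS; rewrite /c (coords_directions v0 cardS).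
    move=> v vS; rewrite /D /m (min_on_eq v0S cdE) min_on_shift cdE//.
    by rewrite opprB addrA subrK.
  have [v vS Dv] := Dmin (c (d t)).
  apply: (glue_local s_local gE _ vS Dv cd); apply: cpos => d0.
  by move: ml; rewrite d0 /l1norm /= !normr0 addr0 leNgt mt.
exists f; split=> [t v pt vS tv|t pt|t k pt k0|t t' pt tt'].
- by rewrite /f ifT ?(gE t v)//; apply: le_trans tv; exact: min_on_le.
- have [mt|mt] := leP (m t) 0; last first.
    have dmc : {for t, continuous dm}.
      have c1 : (m t')^-1 @[t' --> t] --> (m t)^-1.
        have mt0 : m t != 0 by rewrite gt_eqF.
        exact: (cvgV mt0 (mcont t)).
      have cd := dcont t.
      have cd1 := continuous_comp cd (@fst_continuous 'rV[R]_n R (d t)).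
      have cd2 := continuous_comp cd (@snd_continuous 'rV[R]_n R (d t)).
      exact: (cvg_pair (cvgZ c1 cd1) (cvgM c1 cd2)).
    move=> U; rewrite /f leNgt mt /= => UK.
    have := continuous_comp dmc (Kc (dm t)) UK => N.
    have mN := cvgr_gt _ (mcont t) 0 mt.
    suff : \forall t' \near t, U (if m t' <= 0 then g t' else K (dm t')) by [].
    near=> t'; rewrite leNgt.
    have -> : 0 < m t' by near: t'; exact: mN.
    by near: t'; exact: N.
  (* Subtracting the minimum only when it is positive lets both branches of [f] be written as
     [g (th t')] near [t]. This needs [m t < l1norm (d t)]: if [d t] were zero, all coordinates on
     [S] would equal [m t], which is not positive. *)
  pose th (t' : {ptws V -> R}) : {ptws V -> R} :=
    fun v => t' v - Num.max (m t') 0.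
  have tht : th t = t by apply/funext => v; rewrite /th max_r// subr0.
  have thmin x : exists2 v, v \in S & th x v <= 0.
    have [v vS E] := min_on_attained x v0S.
    by exists v => //; rewrite /th subr_le0 le_max -/(m x) /m E lexx.
  have thc : {for t, continuous th}.
    apply: cvg_ptws => v.
    exact: (cvg_subr (@eval_continuous V R v t) (cvg_maxr (mcont t)
      (@cst_continuous _ _ 0 t))).
  have gth : {for t, continuous (fun x => g (th x))}.
    by apply: (glue_cvg s_cont gE thc _ thmin); rewrite tht.
  have lc : {for t, continuous (fun x => l1norm (d x))}.
    exact: (continuous_comp (dcont t) (@l1norm_continuous R n (d t))).
  have ld : m t < l1norm (d t).
    apply: (le_lt_trans mt); apply: l1norm_gt0 => d0.
    have cd v : v \in S -> t v = t (nth v0 S n.+1).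
      move=> vS; apply/eqP; rewrite -subr_eq0 -(coords_directions v0 cardS)//.
      rewrite -/(d t) d0; apply/eqP; rewrite /coords.
      by case: insubP => [j _ _|_] /=; [rewrite mxE|case: ifP].
    have [v vS E] := min_on_attained t v0S.
    have [u uS tu] := pt.
    by move: mt tu; rewrite /m E (cd v)// (cd u)// leNgt => /negP.
  have sub : l1norm (d x) - m x @[x --> t] --> l1norm (d t) - m t.
    exact: (cvg_subr lc (mcont t)).
  have ld' : 0 < l1norm (d t) - m t by rewrite subr_gt0.
  have N : \forall x \near t, 0 < l1norm (d x) - m x
      by exact: (cvgr_gt _ sub 0 ld').
  move=> U; rewrite /f mt -[X in g X]tht => /gth gU.
  suff : \forall t' \near t, U (if m t' <= 0 then g t' else K (dm t')) by [].
  near=> t'.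
  have ptt : pos_on S t' by near: t'; exact: pos_on_near.
  have ml : m t' < l1norm (d t') by rewrite -subr_gt0; near: t'; exact: N.
  have -> : (if m t' <= 0 then g t' else K (dm t')) = g (th t').
    have [m0|m0] := leP (m t') 0.
      by congr g; apply/funext => v; rewrite /th max_r// subr0.
    rewrite gD// ?(ltW ml)//; congr g; apply/funext => v.
    by rewrite /th max_l ?ltW.
  by near: t'; exact: gU.
- rewrite /f /m min_on_scale// -/(m t) pmulr_rle0//.
  case: ifPn => [mt|mt].
    have [v vS E] := min_on_attained t v0S.
    by apply: (glue_scale s_scale gE pt vS _ k0); rewrite -E.
  congr K; rewrite /dm /m min_on_scale// -/(m t).
  have -> : d (scale_pt k t) = (k *: (d t).1, k * (d t).2).
    congr pair; last by rewrite /scale_pt mulrBr.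
    by apply/rowP => j; rewrite !mxE /scale_pt mulrBr.
  rewrite -ltNge in mt.
  have E : (k * m t)^-1 * k = (m t)^-1 by rewrite invfM mulrAC mulVf ?mul1r//
      gt_eqF.
  by congr pair; rewrite ?scalerA ?mulrA E.
- rewrite /f /m -(min_on_eq v0S tt') -/(m t); case: ifPn => [mt|mt].
    have [v vS E] := min_on_attained t v0S.
    by apply: (glue_local s_local gE pt vS _ tt'); rewrite -E.
  congr K; rewrite /dm /m -(min_on_eq v0S tt').
  suff -> : d t' = d t by [].
  have E i : (i < n.+2)%N -> t' (nth v0 S i) = t (nth v0 S i).
    by move=> ni; rewrite tt'//; exact: (vtx_in v0 cardS).
  rewrite /d /directions !E//; congr pair.
  apply/rowP => j; rewrite !mxE E//.
  by apply: leq_trans (ltn_ord j) _; rewrite leqW.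
Unshelve. all: by end_near. Qed.

End SimplexFilling.

(** * Equivariant maps from a join of copies of the group *)

Section EquivariantFamily.
Variables (R : realType) (G : finGroupType) (F : topologicalType).
Variables (a : left_action G F) (I : choiceType).
Let V : choiceType := (I * G)%type.
Local Notation point := {ptws V -> R}.
Implicit Types (v : V) (S T : {fset V}) (g h : G) (t : point).

Definition vact g v : V := (v.1, (g * v.2)%g).
Definition tact g t : point := fun v => t (vact g^-1 v).
Definition sact g S : {fset V} := [fset vact g v | v in S]%fset.

Lemma vact1 v : vact 1 v = v.
Proof. by case: v => i h; rewrite /vact mul1g. Qed.

Lemma vactM g h v : vact (g * h)%g v = vact g (vact h v).
Proof. by rewrite /vact mulgA. Qed.

Lemma vactK g : cancel (vact g) (vact g^-1).
Proof. by move=> v; rewrite -vactM mulVg vact1. Qed.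

Lemma vactKV g : cancel (vact g^-1) (vact g).
Proof. by move=> v; rewrite -vactM mulgV vact1. Qed.

Lemma in_sact g S v : (v \in sact g S) = (vact g^-1 v \in S).
Proof.
apply/imfsetP/idP => [[u uS ->]|vS]; first by rewrite vactK.
by exists (vact g^-1 v); rewrite ?vactKV.
Qed.

Lemma card_sact g S : #|` sact g S| = #|` S|.
Proof. by rewrite card_imfset//; exact: can_inj (vactK g). Qed.

Lemma sact1 S : sact 1 S = S.
Proof. by apply/fsetP => v; rewrite in_sact invg1 vact1. Qed.

Lemma sactM g h S : sact (g * h)%g S = sact g (sact h S).
Proof. by apply/fsetP => v; rewrite !in_sact invMg vactM. Qed.

Lemma sactD1 g S v : sact g (S `\ v)%fset = (sact g S `\ vact g v)%fset.
Proof.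
apply/fsetP => u; rewrite in_sact !in_fsetD1 in_sact; congr (~~ _ && _).
by apply/eqP/eqP => [<-|->]; rewrite ?vactKV ?vactK.
Qed.

Lemma tactM g h t : tact (g * h)%g t = tact g (tact h t).
Proof. by apply/funext => v; rewrite /tact invMg vactM. Qed.

Lemma tact1 t : tact 1 t = t.
Proof. by apply/funext => v; rewrite /tact invg1 vact1. Qed.

Lemma tact_continuous g : continuous (tact g).
Proof. by move=> t; apply: cvg_ptws => v; exact: eval_continuous. Qed.

Lemma pos_on_sact g S t : pos_on S t -> pos_on (sact g S) (tact g t).
Proof.
by move=> [v vS tv]; exists (vact g v); rewrite ?in_sact /tact vactK.
Qed.

(* S spans a simplex of the join: it has at most one vertex in each of the
   copies of G indexed by I. *)
Definition good S := forall v g, v \in S -> vact g v \in S -> g = 1%g.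

Lemma good_sub S T : {subset T <= S} -> good S -> good T.
Proof. by move=> TS gS v g vT gvT; apply: (gS v g); exact: TS. Qed.

Lemma goodD1 S v : good S -> good (S `\ v)%fset.
Proof. by apply: good_sub => u; rewrite !inE => /andP[]. Qed.

Lemma good_sact g S : good S -> good (sact g S).
Proof.
move=> gS v h; rewrite !in_sact => vS hvS; apply: (conjg_inj g); rewrite conj1g.
apply: (gS _ _ vS); rewrite /conjg.
by rewrite !vactM vactKV.
Qed.

(** The action on nonempty good sets is free. This is what lets a filling of one simplex be
    transported around its orbit without conflict. *)
Lemma good_sact_inj S g h : good S -> S != fset0 -> sact g S = sact h S ->
    g = h.
Proof.
move=> gS /fset0Pn[v vS] E; have : vact g v \in sact g S
  by rewrite in_sact vactK.
by rewrite E in_sact -vactM => /(gS _ _ vS)/mulg1_eq; rewrite invgK.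
Qed.

(* A canonical representative of the orbit of S, so that a choice made on
   representatives extends equivariantly. *)
Definition rep S : {fset V} := choose (fun T => [exists g, T == sact g S]) S.

(** The default is never reached, as [shift_rep] shows; for a nonempty good [S] the element is
    unique. *)
Definition shift S : G := odflt 1%g [pick g | S == sact g (rep S)].

Lemma rep_sact g S : rep (sact g S) = rep S.
Proof.
rewrite /rep (@eq_choose _ _ (fun T => [exists h, T == sact h S])).
  apply: choose_id; apply/existsP; first by exists g.
  by exists 1%g; rewrite sact1.
move=> T; apply/existsP/existsP => -[h /eqP ->].
  by exists (h * g)%g; rewrite sactM.
by exists (h * g^-1)%g; rewrite -sactM mulgKV.
Qed.

Lemma shift_rep S : S = sact (shift S) (rep S).
Proof.
rewrite /shift; case: pickP => [g /eqP //|H].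
have : [exists g, rep S == sact g S].
  by apply: (@chooseP _ (fun T => [exists g, T == sact g S])); apply/existsP;
    exists 1%g; rewrite sact1.
by move=> /existsP[g /eqP E]; have := H g^-1%g;
  rewrite E -sactM mulVg sact1 eqxx.
Qed.

Lemma card_rep S : #|` rep S| = #|` S|.
Proof. by rewrite [in RHS](shift_rep S) card_sact. Qed.

Lemma good_rep S : good S -> good (rep S).
Proof.
move=> gS; rewrite -(sact1 (rep S)) -(mulVg (shift S)) sactM -shift_rep.
exact: good_sact.
Qed.

Lemma shift_sact g S : good S -> S != fset0 ->
    shift (sact g S) = (g * shift S)%g.
Proof.
move=> gS S0; apply: (@good_sact_inj (rep S)); first exact: good_rep.
  by rewrite -cardfs_gt0 card_rep cardfs_gt0.
by rewrite sactM -shift_rep -[in LHS](rep_sact g) -shift_rep.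
Qed.

Definition simplex_maps := {fset V} -> point -> F.

(** The last two clauses remove the dependence on the vector representing a point: on its scale and
    on its coordinates off [S]. The next filling needs them of its faces. *)
Definition cell (s : simplex_maps) S :=
  [/\ forall t v, pos_on S t -> v \in S -> t v <= 0 ->
    s S t = s (S `\ v)%fset t,
      forall g t, pos_on S t -> s (sact g S) (tact g t) = a g (s S t),
      forall t, pos_on S t -> {for t, continuous (s S)},
      forall t c, pos_on S t -> 0 < c -> s S (scale_pt c t) = s S t &
      forall t t', pos_on S t -> {in S, t =1 t'} -> s S t = s S t'].

Definition coherent k (s : simplex_maps) :=
  forall S, good S -> (#|` S| <= k)%N -> cell s S.

Lemma pos_on_neq0 S t : pos_on S t -> S != fset0.
Proof. by move=> [v vS _]; apply/fset0Pn; exists v. Qed.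

Lemma coherent0 s : coherent 0 s.
Proof.
by move=> S _; rewrite leqn0 cardfs_eq0 => /eqP ->;
  split=> [t v|g t|t|t c|t t'] /pos_on_neq0; rewrite eqxx.
Qed.

Lemma coherent_filling k s S : coherent k s -> good S -> #|` S| = k.+1 ->
  fillable R F k.+1 -> exists f, filling S (fun v => s (S `\ v)%fset) f.
Proof.
move=> cs gS cardS Fk.
have cardD v : v \in S -> #|` (S `\ v)%fset| = k.
  by move=> vS; apply/eqP; rewrite -eqSS -cardS (cardfsD1 v S) vS.
have cD v : v \in S -> cell s (S `\ v)%fset.
  by move=> vS; apply: cs; [exact: goodD1|rewrite cardD].
have agree u v t : u \in S -> v \in S -> pos_on S t -> t u <= 0 -> t v <= 0 ->
    s (S `\ u)%fset t = s (S `\ v)%fset t.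
  move=> uS vS pt tu tv; have [->//|uv] := eqVneq u v.
  have [c1 _ _ _ _] := cD u uS; have [d1 _ _ _ _] := cD v vS.
  have -> : s (S `\ u)%fset t = s (S `\ u `\ v)%fset t.
    by apply: c1 => //; [exact: pos_on_face|rewrite !inE eq_sym uv].
  have -> : s (S `\ v)%fset t = s (S `\ v `\ u)%fset t.
    by apply: d1 => //; [exact: pos_on_face|rewrite !inE uv].
  by congr s; apply/fsetP => x; rewrite !inE; case: (x == u); case: (x == v).
have cont v t : v \in S -> pos_on (S `\ v)%fset t ->
    {for t, continuous (s (S `\ v)%fset)}.
  by move=> vS; have [_ _ + _ _] := cD v vS; exact.
have scale v t c : v \in S -> pos_on (S `\ v)%fset t -> 0 < c ->
    s (S `\ v)%fset (scale_pt c t) = s (S `\ v)%fset t.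
  by move=> vS; have [_ _ _ + _] := cD v vS; exact.
have local v t t' : v \in S -> pos_on (S `\ v)%fset t ->
    {in (S `\ v)%fset, t =1 t'} ->
    s (S `\ v)%fset t = s (S `\ v)%fset t'.
  by move=> vS; have [_ _ _ _] := cD v vS; exact.
case: k cardS Fk {cs cardD cD} => [|k] cardS Fk.
  have /cardfs1P[v Sv] : #|` S| == 1%N by rewrite cardS.
  exact: filling_vertex Sv Fk.
exact: (filling_simplex agree cont scale local cardS Fk).
Qed.

(** Only the fillings of orbit representatives are used; [shift] carries them to the other
    simplices, and [shift_sact] turns this into equivariance. *)
Lemma coherent_step k s : coherent k s ->
  (forall S, good S -> fillable R F #|` S|) ->
  exists2 s', coherent k.+1 s' & forall S, (#|` S| <= k)%N -> s' S = s S.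
Proof.
move=> cs Fk.
have /choice[psi psiP] : forall S, exists f, good S -> #|` S| = k.+1 ->
    filling S (fun v => s (S `\ v)%fset) f.
  move=> S; have [[gS cardS]|nS] := pselect (good S /\ #|` S| = k.+1).
    have [f Hf] := coherent_filling cs gS cardS (eq_rect _ (fillable R F)
      (Fk _ gS) _ cardS).
    by exists f.
  by exists (s S) => gS cardS; exfalso; apply: nS.
pose s' : simplex_maps := fun S t => if #|` S| == k.+1
  then a (shift S) (psi (rep S) (tact (shift S)^-1 t)) else s S t.
have s'k S : (#|` S| <= k)%N -> s' S = s S.
  by move=> Sk; apply/funext => t; rewrite /s' ltn_eqF.
exists s' => // S gS; rewrite leq_eqVlt => /orP[/eqP cardS|]; last first.
  rewrite ltnS => Sk; have [c1 c2 c3 c4 c5] := cs _ gS Sk.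
  split=> [t v pt vS tv|g t pt|||]; rewrite ?s'k ?card_sact//.
  - exact: c1.
  - by apply: leq_trans Sk; rewrite fsubset_leq_card ?fsubD1set.
  - exact: c2.
have [f1 f2 f3 f4] := psiP _ (good_rep gS) (etrans (card_rep S) cardS).
set h := shift S.
have s'S t : s' S t = a h (psi (rep S) (tact h^-1 t)) by rewrite /s' cardS eqxx.
have posr t : pos_on S t -> pos_on (rep S) (tact h^-1 t).
  move=> pt; have -> : rep S = sact h^-1 S.
    by rewrite [in RHS](shift_rep S) -sactM mulVg sact1.
  exact: pos_on_sact.
split=> [t v pt vS tv|g t pt|t pt|t c pt c0|t t' pt tt'].
- rewrite s'S; have vr : vact h^-1 v \in rep S by rewrite -in_sact -shift_rep.
  have tv' : tact h^-1 t (vact h^-1 v) <= 0 by rewrite /tact invgK vactKV.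
  have cardv : (#|` (rep S `\ vact h^-1 v)%fset| <= k)%N.
    by rewrite -ltnS -cardS -(card_rep S) (cardfsD1 (vact h^-1 v) (rep S)) vr.
  (* The face of the representative has fewer vertices, so equivariance is known there and [h]
     carries it back to the face of [S]. *)
  rewrite (f1 _ _ (posr _ pt) vr tv').
  have [_ c2 _ _ _] := cs _ (goodD1 (good_rep gS)) cardv.
  rewrite -c2; last exact: (pos_on_face vr (posr _ pt) tv').
  rewrite sactD1 -shift_rep vactKV -tactM mulgV tact1 s'k//.
  by rewrite -ltnS -cardS (cardfsD1 v S) vS.
- rewrite s'S /s' card_sact cardS eqxx rep_sact shift_sact ?(pos_on_neq0 pt)//.
  by rewrite -/h lactM invMg tactM -[in tact g^-1 _]tactM mulVg tact1.
- have -> : s' S = (fun t => a h (psi (rep S) (tact h^-1 t))) by apply/funext.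
  have c1 := @tact_continuous h^-1 t.
  have c2 := continuous_comp c1 (f2 _ (posr _ pt)).
  exact: (continuous_comp c2 (@lact_continuous _ _ a h _)).
- by rewrite !s'S; congr (a h _); exact: (f3 _ _ (posr _ pt) c0).
- rewrite !s'S; congr (a h _); apply: f4; first exact: posr.
  move=> v vr; rewrite /tact tt'// invgK.
  by rewrite [in X in _ \in X](shift_rep S) in_sact vactK.
Qed.

(** Stage k is never altered on sets of at most k vertices, so each [S] can be read at the stage
    given by its cardinality. Thus no bound on the dimension is needed when [I] is infinite. *)
Lemma coherent_family (y : F) : (forall S, good S -> fillable R F #|` S|) ->
  exists s, forall S, good S -> cell s S.
Proof.
move=> Fk.
pose sub k := {s : simplex_maps | coherent k s}.
have ext k (s : sub k) : {s' : sub k.+1 |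
    forall S, (#|` S| <= k)%N -> sval s' S = sval s S}.
  have /cid2[s' c' s's] := coherent_step (svalP s) Fk.
  by exists (exist _ s' c').
pose fam := nat_rect sub (exist _ (fun _ _ => y) (@coherent0 _))
  (fun k s => sval (ext k s)).
pose sq k := sval (fam k).
have sqS k S : (#|` S| <= k)%N -> sq k.+1 S = sq k S.
  exact: (svalP (ext k (fam k))).
have sqE k S : (#|` S| <= k)%N -> sq k S = sq #|` S| S.
  elim: k => [|k IH]; first by rewrite leqn0 => /eqP ->.
  rewrite leq_eqVlt => /orP[/eqP -> //|]; rewrite ltnS => Sk.
  by rewrite sqS// IH.
exists (fun S => sq #|` S| S) => S gS.
have [c1 c2 c3 c4 c5] := svalP (fam #|` S|) S gS (leqnn _).
split=> [t v pt vS tv|g t pt|||] //; last by rewrite card_sact; exact: c2.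
have := sqE #|` S| (S `\ v)%fset (fsubset_leq_card (fsubD1set _ _)).
by move=> <-; exact: c1.
Qed.

End EquivariantFamily.

(** * Mapping a space through the join by means of its coordinates *)

Section EquivariantMap.
Variables (R : realType) (G : finGroupType) (F X : topologicalType).
Variables (a : left_action G F) (b : left_action G X) (I : choiceType).
Let V : choiceType := (I * G)%type.
Variable tau : X -> {ptws V -> R}.
Hypothesis tau_continuous : forall v, continuous (fun x => tau x v).
Hypothesis tau_equivariant : forall g x, tau (b g x) = tact g (tau x).
Hypothesis tau_pos : forall x, exists v, 0 < tau x v.
Hypothesis tau_finite : forall x : X, exists S : {fset V},
  \forall y \near x, forall v, 0 < tau y v -> v \in S.
Hypothesis tau_good : forall x v g,
  0 < tau x v -> 0 < tau x (vact g v) -> g = 1%g.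
Hypothesis F_fillable : forall S : {fset V}, good S -> fillable R F #|` S|.

(** The vertices of [S] outside [T] are dropped one at a time by the face condition. *)
Lemma cell_restrict (s : simplex_maps R G F I) (S T : {fset V}) t :
  (forall S, good S -> cell a s S) -> good S -> {subset T <= S} ->
  (forall v, v \in S -> v \notin T -> t v <= 0) -> pos_on T t -> s S t = s T t.
Proof.
move=> cs; move: {2}#|` S| (leqnn #|` S|) => k;
  elim: k S => [|k IH] S Sk gS TS t0 pT.
  have : S = fset0 by apply/eqP; rewrite -cardfs_eq0 -leqn0.
  by case: pT => v /TS + _ => /[swap] ->; rewrite inE.
have pS : pos_on S t by case: pT => v /TS vS tv; exists v.
have [E|/fset0Pn[v]] := eqVneq (S `\` T)%fset fset0.
  have -> // : S = T; apply/fsetP => v; apply/idP/idP; last exact: TS.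
  move=> vS; have := in_fset0 v; rewrite -E inE vS andbT => /negbT.
  by rewrite negbK.
rewrite inE => /andP[vT vS]; have [c1 _ _ _ _] := cs _ gS.
rewrite (c1 t v pS vS (t0 _ vS vT)); apply: IH.
- by rewrite -ltnS; apply: leq_trans Sk;
    rewrite [X in (_ < X)%N](cardfsD1 v S) vS.
- exact: goodD1.
- by move=> u uT; rewrite !inE TS// andbT; apply: contraNneq vT => <-.
- by move=> u; rewrite !inE => /andP[_ uS] uT; exact: t0.
- exact: pT.
Qed.

(** The image of [x] is computed in the simplex [supp x], which is not locally constant. For y near
    x it lies between [supp x] and a fixed finite set: finitely many simplices occur, and the maps
    of those containing [supp x] are continuous at [tau x] with the same value there. *)
Lemma equivariant_map : exists2 f : X -> F,
  continuous f & forall g x, f (b g x) = a g (f x).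
Proof.
have [[y _]|F0] := pselect ([set: F] !=set0); last first.
  (* A point of [X] has a vertex in its support, and filling a single vertex produces a point of
     [F]; so [X] is empty when [F] is. *)
  have X0 (x : X) : False.
    have [[i h] _] := tau_pos x; apply: F0.
    have := @F_fillable [fset (i, h)]%fset; rewrite cardfs1; apply => v g.
    rewrite !inE => /eqP -> /eqP[] /eqP.
    by rewrite -{2}[h]mul1g (inj_eq (mulIg h)) => /eqP.
  by exists (fun x => False_rect F (X0 x)) => [x|g x]; case: (X0 x).
have [s cs] := coherent_family a y F_fillable.
have /choice[supp suppE] : forall x, exists S : {fset V},
    forall v, (v \in S) = (0 < tau x v).
  move=> x; have [S /nbhs_singleton SP] := tau_finite x.
  exists [fset v in S | 0 < tau x v]%fset => v; rewrite !inE /=.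
  by apply: andb_idl; exact: SP.
have good_supp x : good (supp x).
  by move=> v g; rewrite !suppE; exact: tau_good.
have pos_supp x : pos_on (supp x) (tau x).
  by have [v tv] := tau_pos x; exists v; rewrite ?suppE.
exists (fun x => s (supp x) (tau x)); last first.
  move=> g x; have [_ c2 _ _ _] := cs _ (good_supp x).
  rewrite -c2; last exact: pos_supp.
  rewrite tau_equivariant; congr (s _ _).
  by apply/fsetP => v; rewrite in_sact !suppE tau_equivariant.
move=> x U Ux; have [S SP] := tau_finite x.
have tc : {for x, continuous tau} by apply: cvg_ptws => v;
    exact: tau_continuous.
have N1 : \forall y \near x, forall v, v \in enum_fset (supp x) -> 0 < tau y v.
  apply: near_all_mem => v; rewrite suppE => tv.
  exact: (cvgr_gt _ (@tau_continuous v x) 0 tv).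
have N2 : \forall y \near x, forall T, T \in enum_fset (fpowerset S) ->
    good T -> {subset supp x <= T} -> U (s T (tau y)).
  apply: near_all_mem => T _.
  have [gT|ngT] := pselect (good T); last by near=> z => gT; exfalso;
      apply: ngT.
  have [sT|nsT] := pselect {subset supp x <= T}; last first.
    by near=> z => _ sT; exfalso; apply: nsT.
  have pT : pos_on T (tau x) by have [v /sT vT tv] := pos_supp x; exists v.
  have [_ _ c3 _ _] := cs _ gT.
  have E : s T (tau x) = s (supp x) (tau x).
    apply: cell_restrict cs gT sT _ (pos_supp x) => v _.
    by rewrite suppE -leNgt.
  have UT : nbhs (s T (tau x)) U by rewrite E.
  have N := continuous_comp tc (c3 _ pT) UT.
  by near=> z => _ _; near: z; exact: N.
suff : \forall y \near x, U (s (supp y) (tau y)) by [].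
near=> z.
have sub : {subset supp x <= supp z}.
  by move=> v vx; rewrite suppE; move: v vx; near: z; exact: N1.
have zS : supp z \in enum_fset (fpowerset S).
  rewrite fpowersetE; apply/fsubsetP => v; rewrite suppE.
  by move: v; near: z; exact: SP.
by move: (supp z) zS (good_supp z) sub; near: z; exact: N2.
Unshelve. all: by end_near. Qed.

End EquivariantMap.

(** * Paracompact spaces *)

Section Paracompact.
Variables (R : realType) (X : topologicalType).

Lemma closureN (A : set X) (x : X) :
  ~ closure A x <-> exists2 U, nbhs x U & A `&` U = set0.
Proof.
split=> [/existsNP[U /not_implyP[xU AU]]|[U xU AU0] /(_ U xU)].
  by exists U => //; exact/nonemptyPn.
by rewrite AU0 => -[].
Qed.

(** Only finitely many members meet [N]; if [x] were outside the closures of those in [E], one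
    neighbourhood would avoid them all. *)
Lemma closure_locally_finite (D E : set (set X)) (x : X) : E `<=` D ->
  (exists2 N, nbhs x N & finite_set [set V | D V /\ V `&` N !=set0]) ->
  closure (\bigcup_(V in E) V) x -> exists2 V, E V & closure V x.
Proof.
move=> ED [N xN /finite_seqP[s sE]] xE; apply: contrapT => nE.
have : \forall y \near x, forall V, V \in s -> E V -> ~ V y.
  apply: near_all_mem => V _; have [EV|nEV] := pselect (E V); last first.
    by near=> y => EV; exfalso; apply: nEV.
  have /closureN[U xU VU0] : ~ closure V x by move=> cV; apply: nE; exists V.
  by near=> y => _ Vy; have : (V `&` U) y by [split=> //; near: y]; rewrite VU0.
move=> H; have [y [[V EV Vy] [Ny Hy]]] := xE _ (filterI xN H).
apply: (Hy V) => //.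
have : [set V | D V /\ V `&` N !=set0] V by split; [exact: ED|exists y].
by rewrite sE.
Unshelve. all: by end_near. Qed.

Hypothesis X_paracompact : paracompact X.

(** Cover by sets whose closure misses [Q] and by the complement of [K]. In a locally finite
    refinement the members meeting [K] lie in sets of the first kind, and their union is [W]. A
    general [Q] serves both regularity, with a point, and normality. *)
Lemma paracompact_separate (K Q : set X) : closed K ->
  (forall y, K y ->
    exists2 U, open_nbhs y U & forall z, Q z -> ~ closure U z) ->
  exists W, [/\ open W, K `<=` W & forall z, Q z -> ~ closure W z].
Proof.
move=> cK KQ.
pose C := [set U : set X |
  open U /\ ((forall z, Q z -> ~ closure U z) \/ U = ~` K)].
have Cop U : C U -> open U by case.
have Ccov : \bigcup_(U in C) U = [set: X].
  apply/seteqP; split=> // y _; have [Ky|nKy] := pselect (K y).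
    have [U [oU Uy] UQ] := KQ y Ky; exists U => //; split=> //; by left.
  by exists (~` K) => //; split; [exact: closed_openC|right].
have [D [Dop Dcov DC Dfin]] := X_paracompact Cop Ccov.
pose E := [set V : set X | D V /\ V `&` K !=set0].
exists (\bigcup_(V in E) V); split.
- by apply: bigcup_open => V [/Dop].
- move=> y Ky; have : (\bigcup_(V in D) V) y by rewrite Dcov.
  by case=> V DV Vy; exists V => //; split=> //; exists y.
- have ED : E `<=` D by move=> V [].
  move=> z Qz zE.
  have [V [DV [y [Vy Ky]]] Vz] := closure_locally_finite ED (Dfin z) zE.
  have [U [_ [UQ|UK]] VU] := DC V DV; last by have := VU y Vy; rewrite UK.
  by apply: (UQ z Qz); exact: closure_subset VU _ Vz.
Qed.

Hypothesis X_hausdorff : hausdorff_space X.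

Lemma paracompact_regular (x : X) (K : set X) : closed K -> ~ K x ->
  exists W, [/\ open W, K `<=` W & ~ closure W x].
Proof.
move=> cK nKx; have [y Ky|W [oW KW Wx]] := @paracompact_separate K [set x] cK.
- have yx : y != x by apply: contra_notN nKx => /eqP <-.
  move: X_hausdorff; rewrite open_hausdorff => /(_ _ _ yx)[[A B] /=].
  rewrite !inE => -[Ay Bx] [oA oB AB0]; exists A => // z ->.
  apply/closureN; exists B; first exact: (open_nbhs_nbhs (conj oB Bx)).
  exact: AB0.
- by exists W; split=> //; exact: Wx.
Qed.

Lemma paracompact_normal : normal_space X.
Proof.
apply/(@normal_openP R) => K Q cK cQ KQ0.
have [y Ky|W [oW KW WQ]] := @paracompact_separate K Q cK.
- have nQy : ~ Q y by move=> Qy; have : (K `&` Q) y by []; rewrite KQ0.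
  have [W [oW QW Wy]] := paracompact_regular cQ nQy.
  exists (~` closure W).
    by split=> //; apply: closed_openC; exact: closed_closure.
  move=> z Qz; apply/closureN; exists W;
    first exact: (open_nbhs_nbhs (conj oW (QW z Qz))).
  apply/seteqP; split=> // u [/= uW Wu]; apply: uW; exact: subset_closure.
- exists W, (~` closure W); split=> //.
    by apply: closed_openC; exact: closed_closure.
  by apply/seteqP; split=> // u [Wu]; apply; exact: subset_closure.
Qed.

(** By regularity, the open sets whose closure lies in some [A i] form a cover. [C i] collects the
    members of a locally finite refinement with closure in [A i]; local finiteness keeps the closure
    of their union inside [A i]. *)
Lemma paracompact_shrink (I : Type) (A : I -> set X) :
  (forall i, open (A i)) -> (forall x, exists i, A i x) ->
  exists C : I -> set X, [/\ forall i, closed (C i), forall i, C i `<=` A i &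
    forall x, exists i, C i x].
Proof.
move=> Aop Acov; pose B := [set U : set X |
  open U /\ exists i, closure U `<=` A i].
have Bop U : B U -> open U by case.
have Bcov : \bigcup_(U in B) U = [set: X].
  apply/seteqP; split=> // x _; have [i Aix] := Acov x.
  have cA : closed (~` A i) by exact: open_closedC.
  have [W [oW AW Wx]] := paracompact_regular cA (fun n => n Aix).
  exists (~` closure W) => //; split.
    by apply: closed_openC; exact: closed_closure.
  exists i => z /closure_subset H; apply: contrapT => nAz.
  have : ~ closure (~` closure W) z; last first.
    by apply; apply: H; exact: subset_refl.
  apply/closureN; exists W; first exact: (open_nbhs_nbhs (conj oW (AW z nAz))).
  by apply/seteqP; split=> // u [uW Wu]; apply: uW; exact: subset_closure.
have [D [Dop Dcov DB Dfin]] := X_paracompact Bop Bcov.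
pose E i := [set V : set X | D V /\ closure V `<=` A i].
exists (fun i => closure (\bigcup_(V in E i) V)); split=> [i|i x xE|x].
- exact: closed_closure.
- have ED : E i `<=` D by move=> V [].
  by have [V [_ VA] /VA] := closure_locally_finite ED (Dfin x) xE.
- have : (\bigcup_(V in D) V) x by rewrite Dcov.
  case=> V DV Vx; have [U [_ [i UA]] VU] := DB V DV.
  exists i; apply: subset_closure; exists V => //; split=> //.
  exact: subset_trans (closure_subset VU) UA.
Qed.

(** Urysohn functions, with no normalization to a partition of unity: coordinates matter only up to
    a positive factor, so no sum over [I] is formed. *)
Lemma subordinate_functions (I : Type) (A : I -> set X) :
  (forall i, open (A i)) -> (forall x, exists i, A i x) ->
  exists t : I -> X -> R, [/\ forall i, continuous (t i),
    forall i x, 0 <= t i x, forall i x, 0 < t i x -> A i x &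
    forall x, exists i, 0 < t i x].
Proof.
move=> Aop Acov; have [C [Ccl CA Ccov]] := paracompact_shrink Aop Acov.
have /choice[t tP] : forall i, exists f : X -> R, [/\ continuous f,
    range f `<=` `[0, 1], f @` (~` A i) `<=` [set 0] & f @` C i `<=` [set 1]].
  move=> i; apply/uniform_separatorP; apply: ((@normal_separatorP R X).1
    paracompact_normal) => //.
  - exact: open_closedC.
  - by apply/seteqP; split=> // x [nA /CA].
exists t; split=> [i|i x|i x|x].
- by have [] := tP i.
- have [_ t01 _ _] := tP i.
  have /t01 : range (t i) (t i x) by exists x.
  by rewrite /= in_itv/= => /andP[].
- have [_ _ t0 _] := tP i; move=> tx; apply: contrapT => nA.
  have : (t i @` (~` A i)) (t i x) by exists x.
  by move=> /t0 /= E; move: tx; rewrite E ltxx.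
- have [i Cx] := Ccov x; exists i; have [_ _ _ t1] := tP i.
  have /t1 /= -> // : (t i @` C i) (t i x) by exists x.
Qed.

End Paracompact.

(** * Slices and the sectional category *)

Section Slices.
Variables (G : finGroupType) (X : topologicalType) (b : left_action G X).

Lemma lactK g : cancel (b g) (b g^-1%g).
Proof. by move=> x; rewrite -lactM mulVg lact1. Qed.

Definition slice (A : set X) := forall g x, A x -> A (b g x) -> g = 1%g.

(** Each nontrivial g moves [x], so [x] and its translate have disjoint neighbourhoods; finitely
    many such conditions are imposed at once. *)
Lemma free_slice (x : X) : hausdorff_space X -> free_action b ->
  exists2 A, open_nbhs x A & slice A.
Proof.
move=> hX fb.
have sep (g : G) : exists UV : set X * set X, g != 1%g ->
    [/\ open_nbhs x UV.1, open_nbhs (b g x) UV.2 & UV.1 `&` UV.2 = set0].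
  have [->|g1] := eqVneq g 1%g; first by exists (setT, setT).
  have xg : x != b g x by apply: contraNneq g1 => /esym /fb ->.
  move: hX; rewrite open_hausdorff => /(_ _ _ xg)[[A B] /=].
  by rewrite !inE => -[Ay Bx] [oA oB AB0]; exists (A, B) => _; split=> //;
    exact: AB0.
have [UV UVP] := choice sep.
pose P g y := g != 1%g -> (UV g).1 y /\ (UV g).2 (b g y).
have : nbhs x [set y | forall g, g \in enum G -> P g y].
  apply: near_all_mem => g _; have [g1|g1] := eqVneq g 1%g.
    by near=> y; rewrite /P g1 eqxx.
  have [/open_nbhs_nbhs xU /open_nbhs_nbhs gV _] := UVP g g1.
  have N := @lact_continuous _ _ b g x _ gV.
  by near=> y => _; split; [near: y|near: y; exact: N].
rewrite nbhsE => -[A xA AP]; exists A => // g y Ay Agy.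
apply/eqP; apply: contrapT => /negP g1.
have [_ _ UV0] := UVP g g1.
have gG : g \in enum G by rewrite mem_enum.
have [_ Vg] := AP y Ay g gG g1; have [Ug _] := AP _ Agy g gG g1.
have : ((UV g).1 `&` (UV g).2) (b g y) by [].
by rewrite UV0.
Unshelve. all: by end_near. Qed.

End Slices.

Section SlicesToMaps.
Variables (R : realType) (G : finGroupType) (F X : topologicalType).
Variables (a : left_action G F) (b : left_action G X) (I : choiceType).
Variable A : I -> set X.
Hypothesis X_hausdorff : hausdorff_space X.
Hypothesis X_paracompact : paracompact X.
Hypothesis A_open : forall i, open (A i).
Hypothesis A_slice : forall i, slice b (A i).
Hypothesis A_cover : forall x, exists i g, A i (b g x).
Hypothesis A_finite : forall x : X, exists s : seq I,
  \forall y \near x, forall i g, A i (b g y) -> i \in s.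
Hypothesis F_fillable : forall S : {fset I * G}, good S -> fillable R F #|` S|.

Lemma slices_equivariant_map : exists2 f : X -> F,
  continuous f & forall g x, f (b g x) = a g (f x).
Proof.
pose A' (v : I * G) : set X := [set x | A v.1 (b v.2^-1%g x)].
have A'op v : open (A' v).
  by apply: open_comp => // x _; exact: lact_continuous.
have A'cov x : exists v, A' v x.
  by have [i [g Ax]] := A_cover x; exists (i, g^-1%g); rewrite /A' /= invgK.
have [t [tc t0 tA tpos]] :=
  @subordinate_functions R X X_paracompact X_hausdorff _ A' A'op A'cov.
(* Averaging over [G] makes the coordinates equivariant. As [A' (i, g)] is the translate of [A i] by
   [g], the supports stay in the [A' v], and [A i] being a slice leaves at most one positive
   coordinate in each copy of [G]. *)
pose tau x : {ptws (I * G)%type -> R} :=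
    fun v => \sum_(g : G) t (vact g v) (b g x).
have tau_A' x v : 0 < tau x v -> A' v x.
  move=> tx; apply: contrapT => nA; move: tx; rewrite /tau big1 ?ltxx// => g _.
  apply/eqP; rewrite eq_le t0 andbT leNgt; apply/negP => /tA; rewrite /A' /=.
  by rewrite invMg lactM lactK.
apply: (@equivariant_map R G F X a b I tau) => //.
- move=> v x; rewrite /tau; elim: (index_enum G) => [|g s IH].
    rewrite (_ : (fun _ => _) = (fun _ => 0)); first exact: cst_continuous.
    by apply/funext => y; rewrite big_nil.
  rewrite (_ : (fun _ => _) = (fun y => t (vact g v) (b g y) +
      \sum_(g <- s) t (vact g v) (b g y))); last first.
    by apply/funext => y; rewrite big_cons.
  have c1 := continuous_comp (@lact_continuous _ _ b g x)
    (tc (vact g v) (b g x)).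
  exact: (@cvgD _ R^o _ _ _ _ _ _ _ c1 IH).
- move=> g x; apply/funext => v; rewrite /tact /tau.
  rewrite [RHS](reindex_inj (mulIg g)) /=; apply: eq_bigr => h _.
  by rewrite vactM vactKV lactM.
- move=> x; have [v tv] := tpos x; exists v;
    rewrite /tau (bigD1 1%g)//= vact1 lact1.
  by apply: ltr_wpDr => //; apply: sumr_ge0.
- move=> x; have [s sP] := A_finite x.
  exists [fset v in [seq (i, g) | i <- s, g <- enum G]]%fset.
  near=> y => v /tau_A' Av; rewrite !inE; apply/allpairsP; exists v; split.
  + have : forall i g, A i (b g y) -> i \in s by near: y; exact: sP.
    by apply; exact: Av.
  + by rewrite mem_enum.
  + by case: (v).
- move=> x v g /tau_A' Av /tau_A'; rewrite /A' /= invMg lactM => gAv.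
  have E : b (g^-1 ^ v.2)%g (b v.2^-1%g x) = b v.2^-1%g (b g^-1%g x).
    by rewrite -!lactM /conjg -!mulgA mulgV mulg1.
  have /eqP : (g^-1 ^ v.2 = 1)%g by apply: (A_slice Av); rewrite E.
  by rewrite conjg_eq1 invg_eq1 => /eqP.
Unshelve. all: by end_near. Qed.

End SlicesToMaps.

Section OrbitSpace.
Variables (G : finGroupType) (X : topologicalType) (b : left_action G X).
Local Notation p := (orbit_map b).

Lemma orbit_mapP (x y : X) : p x = p y <-> exists g, y = b g x.
Proof.
split=> [/(generic_quotient.eqmodP (orbit_rel b))/existsP[g /eqP ->]|[g ->]];
  first by exists g.
by apply/(generic_quotient.eqmodP (orbit_rel b)); apply/existsP; exists g.
Qed.

Lemma orbit_map_continuous : continuous p.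
Proof. exact: pi_continuous. Qed.

Lemma orbit_map_surj u : exists x, p x = u.
Proof. by exists (generic_quotient.repr u); exact: generic_quotient.reprK. Qed.

Lemma orbit_map_open (A : set X) : open A -> open (p @` A).
Proof.
move=> oA; suff : open (p @^-1` (p @` A)) by [].
have -> : p @^-1` (p @` A) = \bigcup_(g in [set: G]) (b g @^-1` A).
  apply/seteqP; split=> [x [y Ay /orbit_mapP[g ->]]|x [g _ Agx]].
    by exists g^-1%g => //=; rewrite lactK.
  by exists (b g x) => //; apply/orbit_mapP; exists g^-1%g; rewrite lactK.
apply: bigcup_open => g _; apply: open_comp => // x _; exact: lact_continuous.
Qed.

(** On a slice the open map [p] is injective, so the pointwise chosen inverse is continuous. *)
Lemma slice_local_section (A : set X) : open A -> slice b A ->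
  has_local_section p (p @` A).
Proof.
move=> oA sA.
have /choice[s sP] : forall u : p @` A, exists x, A x /\ p x = \val u.
  by move=> u; have [x Ax xu] := set_valP u; exists x.
exists s; split; last by move=> u; case: (sP u).
move=> u O; rewrite nbhsE => -[O' [oO' O'u] O'O].
have oW : open (p @` (O' `&` A)) by apply: orbit_map_open; exact: openI.
have Wu : (p @` (O' `&` A)) (\val u) by have [Au pu] := sP u; exists (s u).
have vc := @initial_continuous _ _ (\val : (p @` A : set _) -> orbit_space b) u.
have N := vc _ (open_nbhs_nbhs (conj oW Wu)).
have Fu : Filter (nbhs u) by exact: nbhs_filter.
suff : nbhs u [set v | O (s v)] by [].
move: N; apply: (@filterS _ _ Fu) => v [y [O'y Ay] yv]; apply: O'O.
have [Av pv] := sP v; have /orbit_mapP[g E] : p (s v) = p y by rewrite pv yv.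
by move: Ay; rewrite E => /(sA _ _ Av) g1; move: O'y; rewrite E g1 lact1.
Qed.

Hypothesis X_hausdorff : hausdorff_space X.
Hypothesis b_free : free_action b.

(** The slice is the image of the section. It is open: for y near x, both y and s (p y) lie in a
    slice around x and in one orbit, hence coincide. *)
Lemma local_section_slice (U : set (orbit_space b)) : open U ->
  has_local_section p U -> exists A, [/\ open A, slice b A &
    forall x, U (p x) -> exists g, A (b g x)].
Proof.
move=> oU [s [sc sp]].
exists [set x | exists2 u : U, \val u = p x & s u = x]; split.
- rewrite openE => x [u ux su].
  have [N [oN Nx] sN] := free_slice x X_hausdorff b_free.
  have : nbhs (s u) N by rewrite su; exact: open_nbhs_nbhs.
  move=> /sc [W [[W' oW' W'E] Wu] WN].
  have W'x : W' (p x) by rewrite -ux; move: Wu; rewrite -W'E.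
  have Ux : U (p x) by rewrite -ux; exact: set_valP.
  have N1 := @orbit_map_continuous x _ (open_nbhs_nbhs (conj oW' W'x)).
  have N2 := @orbit_map_continuous x _ (open_nbhs_nbhs (conj oU Ux)).
  have N3 := open_nbhs_nbhs (conj oN Nx).
  rewrite /interior; near=> y.
  have Uy : U (p y) by near: y; exact: N2.
  have W'y : W' (p y) by near: y; exact: N1.
  have Ny : N y by near: y; exact: N3.
  exists (SigSub (mem_set Uy) : U) => //.
  set v := (SigSub _ : U).
  have Wv : W v by rewrite -W'E.
  have Nv := WN _ Wv.
  have /orbit_mapP[g E] : p y = p (s v) by rewrite sp.
  by move: (Nv : N (s v)); rewrite E => /(sN _ _ Ny) ->; rewrite lact1.
- move=> g x [u ux su] [v vx sv]; apply: (b_free (x := x)).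
  have -> : b g x = s v by [].
  rewrite -[RHS]su; congr s; apply: val_inj; rewrite vx ux.
  by apply/esym/orbit_mapP; exists g.
- move=> x Ux; pose u := (SigSub (mem_set Ux) : U).
  have /orbit_mapP[g E] : p x = p (s u) by rewrite sp.
  exists g; exists u; last exact: E.
  by rewrite -E sp.
Unshelve. all: by end_near. Qed.

End OrbitSpace.

Lemma secatP (E B : topologicalType) (f : E -> B) :
  (exists n : nat, secat f = n%:Z%:E /\ sectional_cover f n) \/
  (secat f = +oo%E /\ forall n, ~ sectional_cover f n).
Proof.
rewrite /secat; case: pselect => [ex|nex].
  by left; case: ex_minnP => n /asboolP cn _; exists n.
by right; split=> // n cn; apply: nex; exists n; apply/asboolP.
Qed.

Lemma secat_le (E B : topologicalType) (f : E -> B) n :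
  sectional_cover f n -> (secat f <= n%:Z%:E)%E.
Proof.
move=> cn; rewrite /secat; case: pselect => [ex|nex]; last first.
  by exfalso; apply: nex; exists n; apply/asboolP.
by case: ex_minnP => m _ mn; rewrite lee_fin lez_nat; apply: mn; apply/asboolP.
Qed.

Section SecatSlices.
Variables (G : finGroupType) (X : topologicalType) (b : left_action G X).
Local Notation p := (orbit_map b).

Definition slice_cover n := exists A : 'I_n -> set X,
  [/\ forall i, open (A i), forall i, slice b (A i) &
      forall x, exists i g, A i (b g x)].

Lemma sectional_slice_cover n : hausdorff_space X -> free_action b ->
  sectional_cover p n -> slice_cover n.
Proof.
move=> hX fb [C [Cn Ccov CP]].
have /card_set_bijP[f [fC _ fsurj]] : (`I_n #= C)%card by rewrite card_eq_sym.
have /choice[A AP] : forall i : 'I_n, exists A, [/\ open A, slice b A &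
    forall x, f i (p x) -> exists g, A (b g x)].
  by move=> i; have [oU sU] := CP _ (fC i (ltn_ord i));
    exact: local_section_slice.
exists A; split=> [i|i|x]; [by have [] := AP i|by have [] := AP i|].
have : (\bigcup_(U in C) U) (p x) by rewrite Ccov.
case=> U /fsurj[k kn <-] fx; exists (Ordinal kn).
by have [_ _] := AP (Ordinal kn); exact.
Qed.

(** Different slices may have the same image in the orbit space, so the number of sets can drop
    below [n]. *)
Lemma slice_cover_sectional n : slice_cover n ->
  exists2 m, (m <= n)%N & sectional_cover p m.
Proof.
move=> [A [Aop As Acov]].
pose f k : set (orbit_space b) :=
  if insub k is Some i then p @` A (i : 'I_n) else set0.
have fE (i : 'I_n) : f i = p @` A i by rewrite /f valK.
have fI k : `I_n k -> exists i : 'I_n, f k = p @` A i.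
  by move=> kn; exists (Ordinal kn); rewrite -fE.
have [m Cm] := (finite_setP (f @` `I_n)).1 (finite_image f (finite_II n)).
exists m.
  rewrite -card_le_II; apply: card_le_trans (card_image_le f `I_n).
  by move: Cm; rewrite card_eq_sym card_eq_le => /andP[].
exists (f @` `I_n); split=> //.
  apply/seteqP; split=> // u _; have [x <-] := orbit_map_surj u.
  have [i [g Agx]] := Acov x; exists (f i); first by exists i => //=.
  by rewrite fE; exists (b g x) => //; apply/orbit_mapP; exists g^-1%g;
    rewrite lactK.
move=> _ [k /fI[i ->] <-]; split; first exact: orbit_map_open.
exact: slice_local_section.
Qed.

End SecatSlices.

Lemma slice_cover_pullback (G : finGroupType) (X Z : topologicalType)
    (b : left_action G X) (c : left_action G Z) (f : Z -> X) n :
  continuous f -> (forall g z, f (c g z) = b g (f z)) ->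
  slice_cover b n -> slice_cover c n.
Proof.
move=> fc fe [A [Aop As Acov]]; exists (fun i => f @^-1` A i);
  split=> [i|i g z|z].
- by apply: open_comp => // z _; exact: fc.
- by rewrite /preimage /= fe; exact: As.
- by have [i [g]] := Acov (f z); exists i, g; rewrite /= fe.
Qed.

Lemma secat_equivariant (G : finGroupType) (X Z : topologicalType)
    (b : left_action G X) (c : left_action G Z) (f : Z -> X) :
  hausdorff_space X -> free_action b ->
  continuous f -> (forall g z, f (c g z) = b g (f z)) ->
  (secat (orbit_map c) <= secat (orbit_map b))%E.
Proof.
move=> hX fb fc fe; have [[n [-> cn]]|[-> _]] := secatP (orbit_map b);
  last exact: leey.
have sc := sectional_slice_cover hX fb cn.
have [m mn cm] := slice_cover_sectional (slice_cover_pullback fc fe sc).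
by apply: le_trans (secat_le cm) _; rewrite lee_fin lez_nat.
Qed.

(** The first projection is injective on a good set. This bounds the dimension of the join by n -
    1. *)
Lemma good_card (G : finGroupType) n (S : {fset 'I_n * G}) : good S ->
    (#|` S| <= n)%N.
Proof.
move=> gS; rewrite -[X in (_ <= X)%N]size_enum_ord.
rewrite -(size_map fst); apply: uniq_leq_size => [|i _];
  last by rewrite mem_enum.
rewrite map_inj_in_uniq ?fset_uniq// => -[i g] [j h] /= ig jh ij.
rewrite -ij in jh *; have := gS (i, g) (h * g^-1)%g ig.
by rewrite /vact /= mulgKV => /(_ jh) /eqP; rewrite -eq_mulgV1 => /eqP ->.
Qed.

Section Fillable.
Variables (R : realType) (F : topologicalType).

(** A simplex with k vertices is bounded by a sphere of dimension k - 2. For k = 1 this is -1, and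
    the condition is that the space be nonempty. *)
Lemma fillable_connectivity (c : \bar int) k :
    connectivity_ge R F (c - 2%:E)%E ->
  (k%:Z%:E <= c)%E -> fillable R F k.
Proof.
move=> Fc; case: k => [//|[|k]] kc.
  have m1 : ((-1)%:E <= c - 2%:E)%E.
    by case: c kc {Fc} => [c||]//=; rewrite ?leey// !lee_fin; lia.
  by have [H _] := Fc _ m1; exact: H.
move=> x0; have mk : (k%:Z%:E <= c - 2%:E)%E.
  by case: c kc {Fc} => [c||]//=; rewrite ?leey// !lee_fin; lia.
by have [_ H] := Fc _ mk; exact: H.
Qed.

End Fillable.

(** * Configuration spaces *)

Section ConfigurationSpace.
Variables (G : finGroupType) (l q : nat) (e : enumeration G l).
Variable Y : topologicalType.
Local Notation act := (conf_action e Y q).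

Lemma conf_hausdorff : hausdorff_space Y -> hausdorff_space (conf_space Y l q).
Proof.
move=> hY y z yz; apply/val_inj; apply/funext => j; apply: hY => A B yA zB.
pose ev (w : conf_space Y l q) : Y := (\val w : {ptws 'I_l -> Y}) j.
have evc : continuous ev.
  move=> w; have vc := @initial_continuous _ _
    (set_val : conf_space Y l q -> {ptws 'I_l -> Y}) w.
  exact: (continuous_comp vc (@eval_continuous 'I_l Y j (\val w))).
have [w [Aw Bw]] := yz _ _ (evc y A yA) (evc z B zB).
by exists (ev w).
Qed.

(* A nontrivial g has order at least q, so a configuration fixed by g would be
   constant on an orbit of size at least q. *)
Lemma conf_free : (q <= pdiv #|G|)%N -> free_action act.
Proof.
move=> qG g y gy; apply/eqP; apply: contrapT => /negP g1.
have ord_g : (q <= #[g]%g)%N.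
  apply: leq_trans qG _; apply: pdiv_min_dvd; first by rewrite order_gt1.
  by rewrite -cardsT; apply: cardSg; exact: finset.subsetT.
have yg k j : (\val y : {ptws 'I_l -> Y}) (idx e (g ^- k * e j)%g) =
    (\val y : {ptws 'I_l -> Y}) j.
  elim: k j => [|k IH] j; first by rewrite invg1 mul1g eltK.
  rewrite expgSr invMg -[in RHS]gy /= /coord_act.
  by have := IH (idx e (g^-1 * e j)%g); rewrite idxK mulgA -invMg -expgS expgSr
    invMg.
pose i (k : 'I_q) := idx e (g ^- k)%g.
have inj_i : injective i.
  move=> k m /(can_inj (idxK e))/invg_inj/eqP; rewrite cyclic.eq_expg_mod_order.
  by rewrite !modn_small ?(leq_trans (ltn_ord _) ord_g)// => /eqP/val_inj.
have [j [k]] := conf_set_inj (set_valP y) inj_i; apply.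
have E m : set_val y (i m) = set_val y (idx e 1%g).
  by have := yg m (idx e 1%g); rewrite idxK mulg1.
exact: (etrans (E j) (esym (E k))).
Qed.

Variables (X : topologicalType) (a : left_action G X).

(** To get back from an equivariant map, evaluate at the coordinate of the neutral element: its
    values at the points u x are the coordinates numbered by the u^-1, and q of these at distinct u
    cannot all agree. *)
Lemma borsuk_ulamN : ~ borsuk_ulam_property a Y q <->
  exists2 f : X -> conf_space Y l q,
    continuous f & forall g x, f (a g x) = act g (f x).
Proof.
split=> [nbu|[f fc fe] bu]; last first.
  pose ev (w : conf_space Y l q) : Y := set_val w (idx e 1%g).
  have evc : continuous ev.
    move=> w; have vc := @initial_continuous _ _
      (set_val : conf_space Y l q -> {ptws 'I_l -> Y}) w.
    exact: (continuous_comp vc (@eval_continuous 'I_l Y (idx e 1%g) (\val w))).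
  have [x [u inj_u ux]] := bu (ev \o f)
    (fun x => continuous_comp (fc x) (evc (f x))).
  pose i k := idx e (u k)^-1%g.
  have inj_i : injective i.
    by move=> k m /(can_inj (idxK e))/invg_inj/inj_u.
  have [j [k]] := conf_set_inj (set_valP (f x)) inj_i; apply.
  have E m : ev (f (a (u m) x)) = set_val (f x) (i m).
    rewrite fe; have -> : ev (act (u m) (f x)) =
      coord_act e (u m) (set_val (f x)) (idx e 1%g) by [].
    by rewrite /coord_act idxK mulg1.
  exact: (etrans (esym (E j)) (etrans (ux j k) (E k))).
have [f fc fx] : exists2 f : X -> Y, continuous f & forall x (u : 'I_q -> G),
    injective u -> exists i j, f (a (u i) x) <> f (a (u j) x).
  apply: contrapT => nf; apply: nbu => f fc; apply: contrapT => nx; apply: nf.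
  exists f => // x u inj_u; apply: contrapT => nij; apply: nx.
  exists x, u => // i j; apply: contrapT => ij; apply: nij; by exists i, j.
pose phi x : {ptws 'I_l -> Y} := fun j => f (a (e j)^-1%g x).
have phiF x : @conf_set Y l q (phi x).
  move=> i imono; apply: (fx x (fun k => (e (i k))^-1%g)) => j k.
  move=> /invg_inj/(can_inj (eltK e)) ijk; apply/val_inj/eqP.
  by case: ltngtP => // /imono; rewrite ijk ltnn.
exists (fun x => SigSub (mem_set (phiF x)) : conf_space Y l q).
  apply: continuous_comp_initial => x; apply: cvg_ptws => j.
  exact: (continuous_comp (@lact_continuous _ _ a (e j)^-1%g x) (fc _)).
move=> g x; apply/val_inj/funext => j; rewrite /= /phi /coord_act idxK.
by rewrite -lactM invMg invgK.
Qed.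

End ConfigurationSpace.

(** Subsets of slices are slices, so a locally finite refinement [D] consists of slices. The family
    is indexed by all sets, those outside [D] giving the empty slice. Finiteness concerns all
    translates of y, which takes one neighbourhood for each g. *)
Lemma paracompact_slices (G : finGroupType) (X : topologicalType)
    (b : left_action G X) :
  hausdorff_space X -> free_action b -> paracompact X ->
  exists A : set X -> set X, [/\ forall i, open (A i), forall i, slice b (A i),
    forall x, exists i g, A i (b g x) &
    forall x : X, exists s : seq (set X),
      \forall y \near x, forall i g, A i (b g y) -> i \in s].
Proof.
move=> hX fb pX.
pose C := [set U : set X | open U /\ slice b U].
have Cop U : C U -> open U by case.
have Ccov : \bigcup_(U in C) U = [set: X].
  apply/seteqP; split=> // x _.
  by have [U [oU Ux] sU] := free_slice x hX fb; exists U.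
have [D [Dop Dcov DC Dfin]] := pX C Cop Ccov.
exists (fun V => [set x | D V /\ V x]); split=> [V|V g x [DV Vx] [_ Vgx]|x|x].
- have [DV|nDV] := pselect (D V).
    rewrite (_ : [set x | _] = V); first exact: Dop.
    by apply/seteqP; split=> x /= => [[]|].
  by rewrite (_ : [set x | _] = set0); [exact: open0|apply/seteqP;
    split=> x /= => [[]|]].
- by have [U [_ sU] VU] := DC V DV; apply: (sU g x); exact: VU.
- have : (\bigcup_(V in D) V) x by rewrite Dcov.
  by case=> V DV Vx; exists V, 1%g; rewrite /= lact1.
- have /choice[Ns NsP] : forall g, exists Ns : set X * seq (set X),
      nbhs (b g x) Ns.1 /\ forall V, D V -> V `&` Ns.1 !=set0 -> V \in Ns.2.
    move=> g; have [N gN /finite_seqP[s sE]] := Dfin (b g x).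
    exists (N, s); split=> // V DV VN.
    by have : [set V | D V /\ V `&` N !=set0] V by []; rewrite sE.
  exists (flatten [seq (Ns g).2 | g <- enum G]).
  have : \forall y \near x, forall g, g \in enum G -> (Ns g).1 (b g y).
    apply: near_all_mem => g _; have [gN _] := NsP g.
    exact: (@lact_continuous _ _ b g x _ gN).
  apply: filterS => y yN V g [DV Vgy]; apply/flattenP; exists (Ns g).2.
    by apply: map_f; rewrite mem_enum.
  by have [_] := NsP g; apply=> //; exists (b g y); split=> //; apply: yN;
    rewrite mem_enum.
Qed.

Theorem theorem3p8 (R : realType) (G : finGroupType) (l q : nat)
  (hG : #|G| = l) (hq2 : (2 <= q)%N) (hq : (q <= pdiv l)%N)
  (e : enumeration G l)
  (X : topologicalType) (a : left_action G X)
  (X_hausdorff : hausdorff_space X) (a_free : free_action a)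
  (X_paracompact : paracompact X)
  (Y : topologicalType) (Y_hausdorff : hausdorff_space Y)
  (Y_conn : connectivity_ge R (conf_space Y l q)
     (secat (orbit_map (conf_action e Y q)) - 2%:E)%E) :
  (secat (orbit_map (conf_action e Y q)) < secat (orbit_map a))%E <->
  borsuk_ulam_property a Y q.
Proof.
have hF := @conf_hausdorff l q Y Y_hausdorff.
have fF : free_action (conf_action e Y q) by apply: conf_free; rewrite hG.
split=> [lt|bu].
  apply: contrapT => /(@borsuk_ulamN G l q e Y X a)[f fc fe].
  by move: lt; rewrite ltNge (secat_equivariant hF fF fc fe).
rewrite ltNge; apply/negP => le.
suff /(@borsuk_ulamN G l q e Y X a) : exists2 f : X -> conf_space Y l q,
  continuous f & forall g x, f (a g x) = conf_action e Y q g (f x) by exact.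
have [[n [En cn]]|[Eoo _]] := secatP (orbit_map (conf_action e Y q)).
  have [[m [Em cm]]|[Eoo _]] := secatP (orbit_map a); last first.
    by move: le; rewrite Eoo En.
  have mn : (m <= n)%N by move: le; rewrite Em En lee_fin lez_nat.
  have [A [Aop As Acov]] := sectional_slice_cover X_hausdorff a_free cm.
  apply: (@slices_equivariant_map R G _ X (conf_action e Y q) a _ A) =>
    // [x|S gS].
    by exists (enum 'I_m); near=> y => i g _; rewrite mem_enum.
  apply: fillable_connectivity Y_conn _.
  by rewrite En lee_fin lez_nat (leq_trans (good_card gS)).
(* With infinite sectional category the hypothesis gives m-connectedness for every m, so simplices
   of any dimension can be filled. *)
have [A [Aop As Acov Afin]] := paracompact_slices X_hausdorff a_free
    X_paracompact.
apply: (@slices_equivariant_map R G _ X (conf_action e Y q) a _ A) => // S gS.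
by apply: fillable_connectivity Y_conn _; rewrite Eoo leey.
Unshelve. all: by end_near. Qed.
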